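(* Let $M$, $\rho:\pi_1(M,x_0)\to G$, and the disjoint hypersurfaces $N,N'\subset M$ be as in the context, with $\mathcal N$ and $\mathcal N'$ the sets of components of their preimages in $\widetilde M$. Let $\gamma:\mathcal N\to G$ and $\alpha:\mathcal N'\to G$ be maps satisfying the equivariance properties (1) and (2) of the context with respect to $\rho$, and let $\gamma_{\mathcal E}:\mathcal N\to G$ and $\alpha_{\mathcal E}:\mathcal N'\to G$ be the transported maps defined in the context. Then the deformations along $N$ and along $N'$ commute: $$\mathcal E_{N,\gamma_{\mathcal E}}\bigl(\mathcal E_{N',\alpha}(\rho)\bigr)=\mathcal E_{N',\alpha_{\mathcal E}}\bigl(\mathcal E_{N,\gamma}(\rho)\bigr).$$
   Context: Setting. $M$ is a connected aspherical manifold (possibly with boundary) of dimension at least $2$ with finitely generated fundamental group and universal cover $\widetilde M$. $N,N'\subset M$ are disjoint, non-homotopic, connected, properly embedded, two-sided, aspherical hypersurfaces whose fundamental groups inject into $\pi_1(M)$, each given an orientation, understood as a choice of positive transverse direction; lifts carry the induced one. $\mathcal N$, $\mathcal N'$ are the sets of connected components of the preimages of $N$, $N'$ in $\widetilde M$. Base points: $\tilde x_0\in\widetilde M$ over $x_0\in M$, $x_0\notin N\cup N'$. $\pi_1(M,x_0)$ acts on $\widetilde M$ by deck transformations, written as a right action: $\tilde x.(AB)=(\tilde x.A).B$. $G$ is an arbitrary Lie group and $\rho:\pi_1(M,x_0)\to G$ a homomorphism. Properties of a map $\gamma:\mathcal N\to G$ with respect to $\rho$ (and similarly for $\alpha:\mathcal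 N'\to G$): (1) $\gamma(N_i)$ commutes with $\rho(A)$ for all $A$ preserving $N_i$; (2) if $A\in\pi_1(M,x_0)$ and $N_j=N_i.A$, then $\gamma(N_j)=\rho(A^{-1})\gamma(N_i)\rho(A)$. Deformation. A minimal path is a path transverse to the elements of $\mathcal N\cup\mathcal N'$ crossing each of them at most once. For $A\in\pi_1(M,x_0)$, let $N_{a_1},\dots,N_{a_k}$ be the elements of $\mathcal N$ crossed in order by a minimal path from $\tilde x_0$ to $\tilde x_0.A$, with intersection signs $s_1,\dots,s_k\in\{\pm1\}$. Then $$\mathcal E_{N,\gamma}(\rho)(A)=\rho(A)\,\gamma(N_{a_k})^{s_k}\cdots\gamma(N_{a_1})^{s_1}.$$ $\mathcal E_{N',\alpha}(\rho)$ is defined in the same way using $\mathcal N'$ and $\alpha$, and the same formulas are used with other maps in place of $\rho,\gamma,\alpha$. Transported maps. For $N_i\in\mathcal N$, let $N'_{b_1},\dots,N'_{b_m}$ be the elements of $\mathcal N'$ crossed in order by a minimal path from $\tilde x_0$ to $N_i$, with signs $\epsilon_1,\dots,\epsilon_m$, and put $\xi_i=\alpha(N'_{b_m})^{\epsilon_m}\cdots\alpha(N'_{b_1})^{\epsilon_1}$; then $\gamma_{\mathcal E}(N_i)=\xi_i^{-1}\gamma(N_i)\xi_i$. For $N'_i\in\mathcal N'$, let $N_{c_1},\dots,N_{c_r}$ be the elements of $\mathcal N$ crossed in order by a minimal path from $\tilde x_0$ to $N'_i$, with signs $\eta_1,\dots,\eta_r$, and put $\zeta_i=\gamma(N_{c_r})^{\eta_r}\cdots\gamma(N_{c_1})^{\eta_1}$;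 then $\alpha_{\mathcal E}(N'_i)=\zeta_i^{-1}\alpha(N'_i)\zeta_i$. *)

(* Defs.v *)
From HB Require Import structures.
From mathcomp Require Import all_boot all_order all_algebra.
From mathcomp Require Import generic_quotient ring lra.
From mathcomp Require Import all_classical all_reals all_analysis.
Import Order.TTheory GRing.Theory Num.Theory.
Import numFieldNormedType.Exports.

Set Implicit Arguments.
Unset Strict Implicit.
Unset Printing Implicit Defensive.

Local Open Scope classical_set_scope.
Local Open Scope ring_scope.
Local Open Scope quotient_scope.

(** * The fundamental group *)

(* Only the values on [0, 1] matter: [tpath_homotopic] ignores the others. *)
Record tpath (R : realType) (T : topologicalType) (x y : T) := TPath {
  tpath_fun :> R -> T;
  tpath_cont : {within `[0, 1], continuous tpath_fun};
  tpath0 : tpath_fun 0 = x;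
  tpath1 : tpath_fun 1 = y }.

HB.instance Definition _ (R : realType) (T : topologicalType) (x y : T) :=
  gen_eqMixin (tpath R x y).
HB.instance Definition _ (R : realType) (T : topologicalType) (x y : T) :=
  gen_choiceMixin (tpath R x y).

Definition tpath_homotopic (R : realType) (T : topologicalType) (x y : T)
    (c d : tpath R x y) : Prop :=
  exists H : R * R -> T,
    [/\ {within `[0, 1] `*` `[0, 1], continuous H},
        forall t : R, t \in `[0, 1] -> H (0, t) = c t,
        forall t : R, t \in `[0, 1] -> H (1, t) = d t,
        forall s : R, s \in `[0, 1] -> H (s, 0) = x &
        forall s : R, s \in `[0, 1] -> H (s, 1) = y].

Section FundamentalGroup.
Variables (R : realType) (T : topologicalType).
Implicit Types (x y : T).

Let clamp (t : R) : R := Num.max 0 (Num.min 1 t).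

Let clamp_itv t : clamp t \in `[0, 1].
Proof.
by rewrite in_itv /= /clamp le_max lexx /= ge_max ler01 ge_min lexx.
Qed.

Let clampE (t : R) : t \in `[0, 1] -> clamp t = t.
Proof.
rewrite in_itv /= => /andP[t0 t1].
by rewrite /clamp (min_idPr t1) (max_idPr t0).
Qed.

Let clamp0 : clamp 0 = 0. Proof. by rewrite clampE // bound_itvE. Qed.
Let clamp1 : clamp 1 = 1. Proof. by rewrite clampE // bound_itvE. Qed.

Let cont_max (f g : R -> R) : continuous f -> continuous g ->
  continuous (fun t => Num.max (f t) (g t)).
Proof. by move=> cf cg t; apply: continuous_max; [exact: cf|exact: cg]. Qed.

Let cont_min (f g : R -> R) : continuous f -> continuous g ->
  continuous (fun t => Num.min (f t) (g t)).
Proof. by move=> cf cg t; apply: continuous_min; [exact: cf|exact: cg]. Qed.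

Let clamp_cont : continuous clamp.
Proof.
apply: cont_max; first by move=> t; exact: cst_continuous.
by apply: cont_min => t; [exact: cst_continuous|exact: cvg_id].
Qed.

Let comp_cont (X Y Z : topologicalType) (f : X -> Y) (g : Y -> Z) :
  continuous f -> continuous g -> continuous (g \o f).
Proof. by move=> cf cg u; apply: continuous_comp; [exact: cf|exact: cg]. Qed.

Let pair_cont (X : topologicalType) (f g : X -> R) :
  continuous f -> continuous g -> continuous (fun u => (f u, g u)).
Proof. by move=> cf cg u; exact: (cvg_pair (cf u) (cg u)). Qed.

Let fst_cont : continuous (@fst R R).
Proof. by move=> u; exact: cvg_fst. Qed.

Let snd_cont : continuous (@snd R R).
Proof. by move=> u; exact: cvg_snd. Qed.

Let affine_cont (a b : R) : continuous (fun t : R => a * t + b).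
Proof.
move=> t; apply: continuousD; last exact: cst_continuous.
by apply: continuousM; [exact: cst_continuous|exact: cvg_id].
Qed.

Let affine_fst (a b : R) : continuous (fun z : R * R => (a * z.1 + b, z.2)).
Proof. exact: (pair_cont (comp_cont fst_cont (@affine_cont a b)) snd_cont). Qed.

Let affine_snd (a b : R) : continuous (fun z : R * R => (z.1, a * z.2 + b)).
Proof. exact: (pair_cont fst_cont (comp_cont snd_cont (@affine_cont a b))). Qed.

Let within_comp (X Y : topologicalType) (A : set X) (f : X -> T) (g : Y -> X) :
  {within A, continuous f} -> continuous g -> (forall u, A (g u)) ->
  continuous (f \o g).
Proof.
move=> /subspace_continuousP cf cg Ag y.
have := cf _ (Ag y).
rewrite /continuous_at => h; apply: (cvg_trans _ h) => U /=.
rewrite /= !nbhs_simpl /= => hU.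
have := cg y _ hU; rewrite /= !nbhs_simpl /=.
by apply: filterS => z /=; apply; exact: Ag.
Qed.

Let ext x y (c : tpath R x y) : R -> T := c \o clamp.

Let ext_cont x y (c : tpath R x y) : continuous (ext c).
Proof.
by apply: within_comp (@tpath_cont _ _ _ _ c) clamp_cont _ => t; exact: clamp_itv.
Qed.

Let within_eq (X : topologicalType) (A : set X) (f h : X -> T) :
  {within A, continuous f} -> (forall u, A u -> f u = h u) ->
  {within A, continuous h}.
Proof.
move=> cf fh; apply: (@subspace_eq_continuous _ A _ f h) cf => u /set_mem.
exact: fh.
Qed.

Let glue (X : topologicalType) (f g : X -> T) (phi : X -> R) (a : R) :
  continuous f -> continuous g -> continuous phi ->
  (forall u, phi u = a -> f u = g u) ->
  continuous (fun u => if phi u <= a then f u else g u).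
Proof.
move=> cf cg cphi fg; set h := (fun u => _).
have cl1 : closed [set u | phi u <= a].
  by apply: (@closed_comp _ _ phi [set t | t <= a]) => [u _|]; [exact: cphi|exact: closed_le].
have cl2 : closed [set u | a <= phi u].
  by apply: (@closed_comp _ _ phi [set t | a <= t]) => [u _|]; [exact: cphi|exact: closed_ge].
apply/continuous_subspace_setT.
have -> : [set: X] = [set u | phi u <= a] `|` [set u | a <= phi u].
  by apply/esym/seteqP; split=> // u _ /=; case: (leP (phi u) a) => [|/ltW]; [left|right].
apply: withinU_continuous => //.
- by apply: (within_eq (continuous_subspaceT cf)) => u /= ua; rewrite /h ua.
- apply: (within_eq (continuous_subspaceT cg)) => u /= au; rewrite /h.
  by case: ifP => // ua; apply/esym/fg/le_anti; rewrite ua.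
Qed.

Let tpath_homotopicP x y (c d : tpath R x y) :
  tpath_homotopic c d <-> exists H : R * R -> T,
    [/\ continuous H, forall t, H (0, t) = c (clamp t),
        forall t, H (1, t) = d (clamp t),
        forall s, H (s, 0) = x & forall s, H (s, 1) = y].
Proof.
split=> -[H [cH H0 H1 Hx Hy]].
- exists (H \o (fun z => (clamp z.1, clamp z.2))); split=> /=.
  + apply: within_comp cH _ _.
      exact: (pair_cont (comp_cont fst_cont clamp_cont)
                        (comp_cont snd_cont clamp_cont)).
    by move=> z; split=> /=; exact: clamp_itv.
  + by move=> t; rewrite clamp0 H0 // clamp_itv.
  + by move=> t; rewrite clamp1 H1 // clamp_itv.
  + by move=> s; rewrite clamp0 Hx // clamp_itv.
  + by move=> s; rewrite clamp1 Hy // clamp_itv.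
- exists H; split=> //.
  + exact: continuous_subspaceT.
  + by move=> t tI; rewrite H0 clampE.
  + by move=> t tI; rewrite H1 clampE.
Qed.

Let reparam x y (c d : tpath R x y) (e : R -> T) (phi psi : R -> R) :
  continuous e -> continuous phi -> continuous psi ->
  phi 0 = psi 0 -> phi 1 = psi 1 ->
  (forall t : R, t \in `[0, 1] -> c t = e (phi t)) ->
  (forall t : R, t \in `[0, 1] -> d t = e (psi t)) ->
  tpath_homotopic c d.
Proof.
move=> ce cphi cpsi E0 E1 ec ed.
have I0 : (0 : R) \in `[0, 1] by rewrite bound_itvE.
have I1 : (1 : R) \in `[0, 1] by rewrite bound_itvE.
exists (fun z => e (phi z.2 + z.1 * (psi z.2 - phi z.2))); split=> /=.
- apply: continuous_subspaceT; apply: comp_cont ce.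
  have c1 := comp_cont snd_cont cphi; have c2 := comp_cont snd_cont cpsi.
  move=> z.
  have cm := continuousM (@fst_cont z) (continuousB (c2 z) (c1 z)).
  exact: (continuousD (c1 z) cm).
- by move=> t tI; rewrite mul0r addr0 ec.
- by move=> t tI; rewrite mul1r addrC subrK ed.
- by move=> s _; rewrite -E0 subrr mulr0 addr0 -ec // tpath0.
- by move=> s _; rewrite -E1 subrr mulr0 addr0 -ec // tpath1.
Qed.

Let homotopic_refl x y (c : tpath R x y) : tpath_homotopic c c.
Proof.
apply: (@reparam _ _ c c (ext c) (fun t => t) (fun t => t)) => //.
- by move=> t; exact: cvg_id.
- by move=> t; exact: cvg_id.
- by move=> t tI; rewrite /ext /= clampE.
- by move=> t tI; rewrite /ext /= clampE.
Qed.

Let homotopic_sym x y (c d : tpath R x y) :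
  tpath_homotopic c d -> tpath_homotopic d c.
Proof.
move=> /tpath_homotopicP [H [cH H0 H1 Hx Hy]]; apply/tpath_homotopicP.
exists (H \o (fun z => (-1 * z.1 + 1, z.2))); split=> /= *.
- exact: (comp_cont (@affine_fst _ _)).
- by rewrite mulr0 add0r H1.
- by rewrite mulN1r addNr H0.
- exact: Hx.
- exact: Hy.
Qed.

Let homotopic_trans x y (c d e : tpath R x y) :
  tpath_homotopic c d -> tpath_homotopic d e -> tpath_homotopic c e.
Proof.
move=> /tpath_homotopicP [H [cH H0 H1 Hx Hy]].
move=> /tpath_homotopicP [K [cK K0 K1 Kx Ky]]; apply/tpath_homotopicP.
exists (fun z => if z.1 <= 2^-1 then (H \o (fun z => (2 * z.1 + 0, z.2))) z
                 else (K \o (fun z => (2 * z.1 + -1, z.2))) z); split=> /=.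
- apply: (glue (phi := fst)).
  + exact: (comp_cont (@affine_fst _ _)).
  + exact: (comp_cont (@affine_fst _ _)).
  + by move=> z; exact: cvg_fst.
  + move=> [s t] /= ->; rewrite divff // addr0 subrr H1 K0 //.
- by move=> t; rewrite invr_ge0 ler0n mulr0 addr0 H0.
- move=> t; case: ifP => [h|_]; first by exfalso; lra.
  by rewrite (_ : 2 * 1 + -1 = 1 :> R) ?K1 //; lra.
- by move=> s; case: ifP.
- by move=> s; case: ifP.
Qed.

Let tpath_cst_cont x : {within `[0, 1], continuous (fun _ : R => x)}.
Proof. by apply: continuous_subspaceT => t; exact: cst_continuous. Qed.

Definition tpath_cst x : tpath R x x := TPath (@tpath_cst_cont x) erefl erefl.

Section Reversal.
Variables (x y : T) (c : tpath R x y).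

Let rev_fun (t : R) : T := c (1 - t).

Let rev_cont : {within `[0, 1], continuous rev_fun}.
Proof.
have cf := comp_cont (@affine_cont (-1) 1) (@ext_cont _ _ c).
apply: (within_eq (continuous_subspaceT cf)) => t /= tI; rewrite /ext /=.
rewrite clampE; last by move: tI; rewrite !in_itv /=; lra.
by rewrite mulN1r addrC.
Qed.

Let rev0 : rev_fun 0 = y. Proof. by rewrite /rev_fun subr0 tpath1. Qed.
Let rev1 : rev_fun 1 = x. Proof. by rewrite /rev_fun subrr tpath0. Qed.

Definition tpath_rev : tpath R y x := TPath rev_cont rev0 rev1.

End Reversal.

Section Concatenation.
Variables (x y z : T) (c : tpath R x y) (d : tpath R y z).

Let cat_fun (t : R) : T := if t <= 2^-1 then c (2 * t) else d (2 * t - 1).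

Let cat_cont : {within `[0, 1], continuous cat_fun}.
Proof.
have cf : continuous (fun t : R => if t <= 2^-1
    then (ext c \o (fun t : R => 2 * t + 0)) t
    else (ext d \o (fun t : R => 2 * t + -1)) t).
  apply: (@glue _ _ _ (fun t : R => t)).
  - exact: (comp_cont (@affine_cont _ _) (@ext_cont _ _ c)).
  - exact: (comp_cont (@affine_cont _ _) (@ext_cont _ _ d)).
  - by move=> t; exact: cvg_id.
  - by move=> u /= ->; rewrite divff // addr0 subrr /ext /= clamp1 clamp0 tpath1 tpath0.
apply: (within_eq (continuous_subspaceT cf)) => t /=.
rewrite in_itv /= => tI; rewrite /cat_fun.
by case: ifP => th; rewrite /ext /= clampE ?addr0 //; rewrite in_itv /=; lra.
Qed.

Let cat0 : cat_fun 0 = x.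
Proof. by rewrite /cat_fun invr_ge0 ler0n mulr0 tpath0. Qed.

Let cat1 : cat_fun 1 = z.
Proof.
rewrite /cat_fun; case: ifP => [h|_]; first by exfalso; lra.
by rewrite (_ : 2 * 1 - 1 = 1 :> R) ?tpath1 //; lra.
Qed.

Definition tpath_cat : tpath R x z := TPath cat_cont cat0 cat1.

End Concatenation.

Lemma tpath_homotopic_equiv x y :
  equiv_class_of (fun c d : tpath R x y => `[< tpath_homotopic c d >]).
Proof.
split=> [c|c d|d c e]; first exact/asboolP.
- by apply/asboolP/asboolP; exact: homotopic_sym.
- by move=> /asboolP cd /asboolP de; apply/asboolP; exact: homotopic_trans cd de.
Qed.

Canonical tpath_homotopic_equivRel x y :=
  EquivRelPack (tpath_homotopic_equiv x y).

Definition pi1 x := {eq_quot (tpath_homotopic_equivRel x x)}.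
HB.instance Definition _ x := Choice.on (pi1 x).

Definition pi1_class x (c : tpath R x x) : pi1 x := \pi_(pi1 x) c.

Lemma pi1_classP x (c d : tpath R x x) :
  pi1_class c = pi1_class d <-> tpath_homotopic c d.
Proof.
split=> [/eqmodP/asboolP //|cd]; exact/eqmodP/asboolP.
Qed.

Lemma pi1_class_surj x (A : pi1 x) : exists c, A = pi1_class c.
Proof. by exists (repr A); rewrite /pi1_class reprK. Qed.

(* In [pi1_mul A B] the loop [B] is traversed first, then [A]: this is the order
   for which deck transformations form a right action of the fundamental
   group, the base point being sent by [A] to the end of the lift of [A]. *)
Definition pi1_one x : pi1 x := pi1_class (tpath_cst x).
Definition pi1_inv x (A : pi1 x) : pi1 x := pi1_class (tpath_rev (repr A)).
Definition pi1_mul x (A B : pi1 x) : pi1 x :=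
  pi1_class (tpath_cat (repr B) (repr A)).

Let repr_class x (c : tpath R x x) : tpath_homotopic (repr (pi1_class c)) c.
Proof. by apply/pi1_classP; rewrite /pi1_class reprK. Qed.

Lemma pi1_invE x (c : tpath R x x) :
  pi1_inv (pi1_class c) = pi1_class (tpath_rev c).
Proof.
apply/pi1_classP.
have /tpath_homotopicP [H [cH H0 H1 Hx Hy]] := repr_class c.
exists (H \o (fun z => (z.1, -1 * z.2 + 1))); split=> /=.
- by apply: continuous_subspaceT; exact: (comp_cont (@affine_snd _ _)).
- by move=> t tI; rewrite H0 clampE; [congr (_ _); lra|move: tI; rewrite !in_itv /=; lra].
- by move=> t tI; rewrite H1 clampE; [congr (_ _); lra|move: tI; rewrite !in_itv /=; lra].
- by move=> s _; rewrite mulr0 add0r.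
- by move=> s _; rewrite mulN1r addNr.
Qed.

Lemma pi1_mulE x (c d : tpath R x x) :
  pi1_mul (pi1_class c) (pi1_class d) = pi1_class (tpath_cat d c).
Proof.
apply/pi1_classP.
have /tpath_homotopicP [H [cH H0 H1 Hx Hy]] := repr_class d.
have /tpath_homotopicP [K [cK K0 K1 Kx Ky]] := repr_class c.
exists (fun z => if z.2 <= 2^-1 then (H \o (fun z => (z.1, 2 * z.2 + 0))) z
                 else (K \o (fun z => (z.1, 2 * z.2 + -1))) z); split=> /=.
- apply: continuous_subspaceT; apply: (glue (phi := snd)).
  + exact: (comp_cont (@affine_snd _ _)).
  + exact: (comp_cont (@affine_snd _ _)).
  + by move=> z; exact: cvg_snd.
  + by move=> [s t] /= ->; rewrite divff // addr0 subrr Hy Kx.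
- move=> t; rewrite in_itv /= => tI; case: ifP => th.
    by rewrite H0 clampE ?addr0 // in_itv /=; lra.
  by rewrite K0 clampE // in_itv /=; lra.
- move=> t; rewrite in_itv /= => tI; case: ifP => th.
    by rewrite H1 clampE ?addr0 // in_itv /=; lra.
  by rewrite K1 clampE // in_itv /=; lra.
- by move=> s _; rewrite invr_ge0 ler0n mulr0 addr0 Hx.
- move=> s _; case: ifP => [h|_]; first by exfalso; lra.
  by rewrite (_ : 2 * 1 + -1 = 1 :> R) ?Ky //; lra.
Qed.

Let cst_cont (a : R) : continuous (fun _ : R => a).
Proof. by move=> t; exact: cst_continuous. Qed.

Let pi1_mulA x : associative (@pi1_mul x).
Proof.
move=> A B C.
have [a ->] := pi1_class_surj C; have [b ->] := pi1_class_surj B.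
have [c ->] := pi1_class_surj A; rewrite !pi1_mulE; apply/pi1_classP.
apply: homotopic_sym.
pose f (t : R) := if t <= 1 then ext a t else
   if t <= 2 then (ext b \o (fun t : R => 1 * t + -1)) t
   else (ext c \o (fun t : R => 1 * t + -2)) t.
have cf : continuous f.
  apply: (@glue _ _ _ (fun t : R => t)).
  - exact: ext_cont.
  - apply: (@glue _ _ _ (fun t : R => t)).
    + exact: (comp_cont (@affine_cont _ _) (@ext_cont _ _ b)).
    + exact: (comp_cont (@affine_cont _ _) (@ext_cont _ _ c)).
    + by move=> t; exact: cvg_id.
    + move=> u /= ->; rewrite /ext /= (_ : 1 * 2 + -1 = 1 :> R); last by lra.
      by rewrite mul1r subrr clamp1 clamp0 tpath1 tpath0.
  - by move=> t; exact: cvg_id.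
  - move=> u /= ->; rewrite ler1n /ext /= mul1r subrr.
    by rewrite clamp1 clamp0 tpath1 tpath0.
have fa t : t \in `[0, 1] -> f t = a t.
  by move=> tI; move: (tI); rewrite /f in_itv /= => /andP[_ ->]; rewrite /ext /= clampE.
have fb t : t \in `[0, 1] -> f (t + 1) = b t.
  move=> tI; move: (tI); rewrite /f in_itv /= => /andP[t0 t1].
  case: ifP => [h|_].
    have -> : t = 0 by lra.
    by rewrite add0r /ext /= clamp1 tpath1 tpath0.
  by rewrite ifT; [rewrite /ext /= mul1r addrK clampE|lra].
have fc t : t \in `[0, 1] -> f (t + 2) = c t.
  move=> tI; move: (tI); rewrite /f in_itv /= => /andP[t0 t1].
  rewrite ifF; last by lra.
  case: ifP => [h|_].
    have -> : t = 0 by lra.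
    by rewrite add0r /ext /= (_ : 1 * 2 + -1 = 1 :> R) ?clamp1 ?tpath1 ?tpath0 //; lra.
  by rewrite /ext /= mul1r addrK clampE.
apply: (@reparam _ _ _ _ f (fun t => Num.max (2 * t + 0) (4 * t + -1))
                           (fun t => Num.min (4 * t + 0) (2 * t + 1))) => //.
- by apply: cont_max; exact: affine_cont.
- by apply: cont_min; exact: affine_cont.
- by rewrite maxEle minEle; do 2 case: ifP => ?; lra.
- by rewrite maxEle minEle; do 2 case: ifP => ?; lra.
- move=> t; rewrite in_itv /= => /andP[t0 t1]; rewrite /tpath_cat /=.
  case: ifP => h1; last case: ifP => h2.
  + rewrite -fa ?in_itv /=; last by lra.
    by congr f; rewrite maxEle; case: ifP => ?; lra.
  + rewrite -fb ?in_itv /=; last by lra.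
    by congr f; rewrite maxEle; case: ifP => ?; lra.
  + rewrite -fc ?in_itv /=; last by lra.
    by congr f; rewrite maxEle; case: ifP => ?; lra.
- move=> t; rewrite in_itv /= => /andP[t0 t1]; rewrite /tpath_cat /=.
  case: ifP => h1; first case: ifP => h2.
  + rewrite -fa ?in_itv /=; last by lra.
    by congr f; rewrite minEle; case: ifP => ?; lra.
  + rewrite -fb ?in_itv /=; last by lra.
    by congr f; rewrite minEle; case: ifP => ?; lra.
  + rewrite -fc ?in_itv /=; last by lra.
    by congr f; rewrite minEle; case: ifP => ?; lra.
Qed.

Let id_cont : continuous (fun t : R => t).
Proof. by move=> t; exact: cvg_id. Qed.

Let pi1_mulg1 x : right_id (pi1_one x) (@pi1_mul x).
Proof.
move=> A; have [a ->] := pi1_class_surj A; rewrite pi1_mulE; apply/pi1_classP.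
apply: (@reparam _ _ _ _ (ext a) (fun t => Num.max 0 (2 * t + -1)) (fun t => t)).
- exact: ext_cont.
- by apply: cont_max; [exact: cst_cont|exact: affine_cont].
- exact: id_cont.
- by rewrite maxEle; case: ifP => ?; lra.
- by rewrite maxEle; case: ifP => ?; lra.
- move=> t; rewrite in_itv /= => tI; rewrite maxEle; case: ifP => h; case: ifP => h'.
  + have -> : 2 * t + -1 = 0 by lra.
    by rewrite /ext /= clamp0 tpath0.
  + by rewrite /ext /= clamp0 tpath0.
  + by rewrite /ext /= clampE // in_itv /=; lra.
  + by exfalso; lra.
- by move=> t tI; rewrite /ext /= clampE.
Qed.

Let pi1_mul1g x : left_id (pi1_one x) (@pi1_mul x).
Proof.
move=> A; have [a ->] := pi1_class_surj A; rewrite pi1_mulE; apply/pi1_classP.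
apply: (@reparam _ _ _ _ (ext a) (fun t => Num.min (2 * t + 0) 1) (fun t => t)).
- exact: ext_cont.
- by apply: cont_min; [exact: affine_cont|exact: cst_cont].
- exact: id_cont.
- by rewrite minEle; case: ifP => ?; lra.
- by rewrite minEle; case: ifP => ?; lra.
- move=> t; rewrite in_itv /= => tI; rewrite minEle; case: ifP => h; case: ifP => h'.
  + by rewrite /ext /= addr0 clampE // in_itv /=; lra.
  + by exfalso; lra.
  + have -> : 2 * t + 0 = 1 by lra.
    by rewrite /ext /= clamp1 tpath1.
  + by rewrite /ext /= clamp1 tpath1.
- by move=> t tI; rewrite /ext /= clampE.
Qed.

Let pi1_mulgV x : right_inverse (pi1_one x) (@pi1_inv x) (@pi1_mul x).
Proof.
move=> A; have [a ->] := pi1_class_surj A; rewrite pi1_invE pi1_mulE; apply/pi1_classP.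
apply: (@reparam _ _ _ _ (ext a) (fun t => Num.max (-2 * t + 1) (2 * t + -1)) (fun=> 1)).
- exact: ext_cont.
- by apply: cont_max; exact: affine_cont.
- exact: cst_cont.
- by rewrite maxEle; case: ifP => ?; lra.
- by rewrite maxEle; case: ifP => ?; lra.
- move=> t; rewrite in_itv /= => tI; rewrite maxEle; case: ifP => h; case: ifP => h'.
  + by rewrite /ext /= clampE; [congr (_ _); lra|rewrite in_itv /=; lra].
  + by rewrite /ext /= clampE; [congr (_ _); lra|rewrite in_itv /=; lra].
  + by rewrite /ext /= clampE; [congr (_ _); lra|rewrite in_itv /=; lra].
  + by exfalso; lra.
- by move=> t tI; rewrite /ext /= clamp1 tpath1.
Qed.

Let pi1_mulVg x : left_inverse (pi1_one x) (@pi1_inv x) (@pi1_mul x).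
Proof.
move=> A; have [a ->] := pi1_class_surj A; rewrite pi1_invE pi1_mulE; apply/pi1_classP.
apply: (@reparam _ _ _ _ (ext a) (fun t => Num.min (2 * t + 0) (-2 * t + 2)) (fun=> 0)).
- exact: ext_cont.
- by apply: cont_min; exact: affine_cont.
- exact: cst_cont.
- by rewrite minEle; case: ifP => ?; lra.
- by rewrite minEle; case: ifP => ?; lra.
- move=> t; rewrite in_itv /= => tI; rewrite minEle; case: ifP => h; case: ifP => h'.
  + by rewrite /ext /= clampE; [congr (_ _); lra|rewrite in_itv /=; lra].
  + by exfalso; lra.
  + by rewrite /ext /= clampE; [congr (_ _); lra|rewrite in_itv /=; lra].
  + by rewrite /ext /= clampE; [congr (_ _); lra|rewrite in_itv /=; lra].
- by move=> t tI; rewrite /ext /= clamp0 tpath0.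
Qed.

HB.instance Definition _ x := isGroup.Build (pi1 x) (@pi1_mulA x)
  (@pi1_mul1g x) (@pi1_mulg1 x) (@pi1_mulVg x) (@pi1_mulgV x).

End FundamentalGroup.
Arguments pi1 R {T} x.

Section Pi1Map.
Variables (R : realType) (T U : topologicalType) (f : T -> U).
Hypothesis cf : continuous f.

Section PathMap.
Variables (x y : T) (c : tpath R x y).

Let map_cont : {within `[0, 1], continuous (fun t : R => f (c t))}.
Proof.
have /subspace_continuousP h := @tpath_cont _ _ _ _ c.
by apply/subspace_continuousP => t tI; exact: (@cvg_comp _ _ _ c f _ _ _ (h t tI) (@cf (c t))).
Qed.

Let map0 : f (c 0) = f x. Proof. by rewrite tpath0. Qed.
Let map1 : f (c 1) = f y. Proof. by rewrite tpath1. Qed.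

Definition tpath_map : tpath R (f x) (f y) := TPath map_cont map0 map1.

End PathMap.

Definition pi1_map (x : T) (A : pi1 R x) : pi1 R (f x) :=
  pi1_class (tpath_map (repr A)).

End Pi1Map.

Definition simply_connected (R : realType) (T : topologicalType) : Prop :=
  (forall x y : T, inhabited (tpath R x y)) /\
  (forall (x : T) (A : pi1 R x), A = 1%g).

Definition finitely_generated (G : groupType) : Prop :=
  exists S : seq G, forall P : set G,
    P 1%g -> (forall a b, P a -> P b -> P (a * b)%g) ->
    (forall a, P a -> P a^-1%g) -> (forall a, a \in S -> P a) ->
    forall a, P a.

(* Vanishing of the homotopy groups of degree k >= 2, in extension form: every
   map from the k-sphere extends to the (k+1)-disk. The norm is Euclidean,
   not the sup norm that the library puts on row vectors. *)
Definition aspherical (R : realType) (T : topologicalType) : Prop :=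
  forall k : nat, (2 <= k)%N -> forall f : 'rV[R]_k.+1 -> T,
    let sphere := [set v : 'rV[R]_k.+1 | \sum_i v ord0 i ^+ 2 = 1] in
    let disk := [set v : 'rV[R]_k.+1 | \sum_i v ord0 i ^+ 2 <= 1] in
    {within sphere, continuous f} ->
    exists g : 'rV[R]_k.+1 -> T,
      {within disk, continuous g} /\ (forall v, sphere v -> g v = f v).

(** * Manifolds and Lie groups *)

Record chart (T V : topologicalType) := Chart {
  dom : set T;
  cod : set V;
  fwd : T -> V;
  bwd : V -> T;
  dom_open : open dom;
  fwd_cont : {within dom, continuous fwd};
  bwd_cont : {within cod, continuous bwd};
  fwd_cod : forall x, dom x -> cod (fwd x);
  bwd_dom : forall v, cod v -> dom (bwd v);
  fwdK : forall x, dom x -> bwd (fwd x) = x;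
  bwdK : forall v, cod v -> fwd (bwd v) = v }.

Definition half_space (R : realType) (n : nat) : set 'rV[R]_n.+1 :=
  [set v | 0 <= v ord0 ord0].

Definition boundary_chart (R : realType) (n : nat) (T : topologicalType)
    (e : chart T 'rV[R]_n.+1) : Prop :=
  exists2 W : set 'rV[R]_n.+1, open W & cod e = W `&` @half_space R n.

(* The dimension is n.+1, and the boundary may be empty. *)
Definition manifold (R : realType) (n : nat) (T : topologicalType) : Prop :=
  [/\ hausdorff_space T, @second_countable T &
      forall x : T, exists2 e : chart T 'rV[R]_n.+1, boundary_chart e & dom e x].

(* On an open set, C^(k+1) means that all directional derivatives exist and are
   C^k. *)
Fixpoint Ck (R : realType) (V W : normedModType R) (k : nat) (U : set V)
    (f : V -> W) : Prop :=
  match k with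
  | 0 => {within U, continuous f}
  | k'.+1 => [/\ {within U, continuous f},
                 forall x v, U x -> derivable f x v &
                 forall v, Ck k' U (fun x => 'D_v f x)]
  end.

Definition smooth (R : realType) (V W : normedModType R) (U : set V)
    (f : V -> W) : Prop := forall k, Ck k U f.

#[short(type="groupWithTopologyType")]
HB.structure Definition GroupWithTopology := {G of Group G & Topological G}.

Definition lie_group (R : realType) (G : groupWithTopologyType) : Prop :=
  [/\ hausdorff_space G, @second_countable G,
      continuous (fun z : G * G => (z.1 * z.2)%g),
      continuous (fun a : G => (a^-1)%g) &
  exists (d : nat) (atlas : set (chart G 'rV[R]_d)),
  [/\ forall e, atlas e -> open (cod e),
      forall a, exists2 e, atlas e & dom e a,
      forall e e', atlas e -> atlas e' ->
        smooth [set v | cod e v /\ dom e' (bwd e v)]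
               (fun v => fwd e' (bwd e v)),
      forall e1 e2 e3, atlas e1 -> atlas e2 -> atlas e3 ->
        smooth [set z : 'rV[R]_d * 'rV[R]_d | [/\ cod e1 z.1, cod e2 z.2 &
                  dom e3 (bwd e1 z.1 * bwd e2 z.2)%g]]
               (fun z => fwd e3 (bwd e1 z.1 * bwd e2 z.2)%g) &
      forall e e', atlas e -> atlas e' ->
        smooth [set v | cod e v /\ dom e' (bwd e v)^-1%g]
               (fun v => fwd e' (bwd e v)^-1%g)]].

(** * Hypersurfaces *)

(* A connected, properly embedded, cooriented, aspherical, pi_1-injective
   hypersurface. The last coordinate of the charts cuts it out and the
   first one cuts out the boundary of M, so (in dimension at least 2) the
   embedding is locally flat and meets the boundary of M exactly, and neatly,
   along its own boundary. Only the germs of [hs_pos] and [hs_neg] along the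
   hypersurface matter: they are its positive and negative sides. *)
Record hypersurface (R : realType) (n : nat) (M : topologicalType) :=
  Hypersurface {
  hs_set :> set M;
  hs_pos : set M;
  hs_neg : set M;
  hs_nonempty : hs_set !=set0;
  hs_connected : connected hs_set;
  hs_closed : closed hs_set;
  hs_flat : forall x, hs_set x ->
    exists e : chart M 'rV[R]_n.+1,
      [/\ boundary_chart e, dom e x &
          forall y, dom e y ->
            [/\ hs_set y <-> fwd e y ord0 ord_max = 0,
                hs_pos y <-> 0 < fwd e y ord0 ord_max &
                hs_neg y <-> fwd e y ord0 ord_max < 0]];
  hs_aspherical : aspherical R hs_set;
  hs_pi1_inj : forall y : hs_set,
    injective (@pi1_map R _ _ set_val
                 (@initial_continuous hs_set M set_val) y) }.

(* The inclusions are homotopic, up to a homeomorphism [h]. *)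
Definition homotopic_subsets (R : realType) (M : topologicalType)
    (N N' : set M) : Prop :=
  exists (H : R * N -> M) (h : N -> N') (k : N' -> N),
    [/\ continuous h, continuous k, cancel h k & cancel k h] /\
    [/\ {within `[0, 1] `*` setT, continuous H},
        forall y, H (0, y) = set_val y & forall y, H (1, y) = set_val (h y)].

(** * The universal cover *)

Definition covering_map (E B : topologicalType) (p : E -> B) : Prop :=
  set_surj setT setT p /\
  forall b : B, exists (U : set B) (sheets : set (set E)),
    [/\ open U, U b, p @^-1` U = \bigcup_(V in sheets) V,
        forall V V', sheets V -> sheets V' -> V `&` V' !=set0 -> V = V' &
        forall V, sheets V ->
          exists e : chart E B, [/\ dom e = V, cod e = U & fwd e = p]].

Definition universal_cover (R : realType) (E B : topologicalType)
    (p : E -> B) : Prop :=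
  covering_map p /\ simply_connected R E.

Definition deck_transformation (E B : topologicalType) (p : E -> B)
    (f : E -> E) : Prop :=
  [/\ continuous f, (exists2 g, continuous g & cancel f g /\ cancel g f) &
      p \o f = p].

Section Deformation.
Variables (R : realType) (n : nat) (M E : topologicalType) (p : E -> M).
Variables (x0 : M) (e0 : E).
Implicit Types (S : hypersurface R n M) (Sigma : set (hypersurface R n M)).
Implicit Types (A : pi1 R x0) (c : R -> E).

(* [deck_action A y] is y.A: the deck transformation that sends the base point
   e0 to the end of the lift, starting from e0, of a loop in the class A. For a
   universal cover it exists and is unique, so the default [id] is never used. *)
Definition deck_action A : E -> E :=
  xget (idfun : E -> E) [set f | deck_transformation p f /\
    exists (a : tpath R x0 x0) (c : tpath R e0 (f e0)),
      A = pi1_class a /\ forall t : R, t \in `[0, 1] -> p (c t) = a t].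

Definition lift_at S (y : E) : set E := connected_component (p @^-1` S) y.

Definition lifts S : set (set E) := [set lift_at S y | y in p @^-1` S].

Definition crosses_pos S c (t : R) : Prop :=
  (\forall s \near t^'-, hs_neg S (p (c s))) /\
  (\forall s \near t^'+, hs_pos S (p (c s))).

Definition crosses_neg S c (t : R) : Prop :=
  (\forall s \near t^'-, hs_pos S (p (c s))) /\
  (\forall s \near t^'+, hs_neg S (p (c s))).

(* Transversality is required at interior times only: the final point may
   lie on a lift, which is then met at no other time. *)
Definition minimal_path Sigma c : Prop :=
  {within `[0, 1], continuous c} /\
  forall S, Sigma S ->
    (forall t : R, 0 < t < 1 -> hs_set S (p (c t)) ->
       crosses_pos S c t \/ crosses_neg S c t) /\
    (forall C, lifts S C -> forall t t' : R, t \in `[0, 1] -> t' \in `[0, 1] ->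
       C (c t) -> C (c t') -> t = t').

Definition minimal_path_to Sigma (B : set E) : R -> E :=
  xget (cst e0 : R -> E) [set c | [/\ minimal_path Sigma c, c 0 = e0 & B (c 1)]].

(* The set below has exactly one element when [c] is minimal. *)
Definition crossing_times S c : seq R :=
  xget [::] [set ts | sorted <%R ts /\
    forall t, t \in ts <-> 0 < t < 1 /\ hs_set S (p (c t))].

Variable G : groupWithTopologyType.
Implicit Types (rho : pi1 R x0 -> G) (gamma alpha : set E -> G).

(* gamma(C_k)^(s_k) ... gamma(C_1)^(s_1), where C_1, ..., C_k are the lifts of S
   crossed by c, in this order. *)
Definition crossing_product S gamma c : G :=
  (\prod_(t <- rev (crossing_times S c))
     if `[< crosses_pos S c t >] then gamma (lift_at S (c t))
     else (gamma (lift_at S (c t)))^-1)%g.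

(* Maps on the set of lifts are represented by functions on [set E], of which
   only the values on [lifts S] are relevant. *)
Definition equivariant rho S gamma : Prop :=
  (forall C A, lifts S C -> deck_action A @` C = C ->
     commute (gamma C) (rho A)) /\
  (forall C A, lifts S C ->
     gamma (deck_action A @` C) = (rho A^-1 * gamma C * rho A)%g).

Definition deformation Sigma S gamma rho : pi1 R x0 -> G :=
  fun A => (rho A *
    crossing_product S gamma
      (minimal_path_to Sigma [set deck_action A e0]))%g.

(* The map gamma of one hypersurface, transported by the pair (S, alpha). *)
Definition transport Sigma S alpha gamma : set E -> G :=
  fun C => let xi := crossing_product S alpha (minimal_path_to Sigma C) in
           (xi^-1 * gamma C * xi)%g.

End Deformation.

(* Main.v *)
Require Import Defs.
From mathcomp Require Import all_boot all_order all_algebra.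
From mathcomp Require Import lra.
From mathcomp Require Import all_classical all_reals all_analysis.
Import Order.TTheory GRing.Theory Num.Theory.
Import numFieldNormedType.Exports.

(** The theorem holds because a crossing product is the parallel transport of a
    flat principal G-bundle over the universal cover, so that it can be computed
    without looking at the path.

    Fix a hypersurface S and a map gamma from its lifts to G. Call a function f
    from the universal cover to G a section if it is locally constant off the
    lifts of S and if, across each lift C, its value on the positive side is
    gamma(C) times its value on the negative side. Sections exist locally, and
    two of them differ locally by a constant right factor; as the cover is simply
    connected, there is a global section with value 1 at the base point
    ([jump_section], from [global_section]). Along a path c transverse to S, such
    an f changes at each crossing by the corresponding letter, whence
    [crossing_productE]: the crossing product of c is f(c 1) f(c 0)^-1.

    Now let f be the global section of (N', alpha). As N and N' are disjoint, f is
    constant on each lift C of N, and the map transported from gamma is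
    gamma_E(C) = f(C)^-1 gamma(C) f(C) on every lift crossed by a minimal path
    from the base point ([transportE]). If k is the global section for this
    conjugated map, then f k is locally constant off the lifts of N and of N',
    jumps by gamma across the former since f (f^-1 gamma f) k = gamma (f k), and
    jumps by alpha across the latter. The iterated deformation of rho at A is
    rho(A) times the value of f k at the end of the path chosen for A
    ([composite_section]). In the other order one gets a function with the same
    jumps and the same value 1 at the base point; the two functions are equal
    ([section_unique]). *)

Set Implicit Arguments.
Unset Strict Implicit.
Unset Printing Implicit Defensive.

Local Open Scope classical_set_scope.
Local Open Scope ring_scope.

(** * Local constancy and subdivision *)

Lemma locally_constant_connected (T : topologicalType) (Y : Type) (A : set T)
    (f : T -> Y) :
  connected A -> (forall x, A x -> \forall z \near x, A z -> f z = f x) ->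
  forall x y, A x -> A y -> f x = f y.
Proof.
move=> cA lf x y Ax Ay.
pose B := [set z | A z /\ f z = f x].
suff: B = A by move=> BA; have [] : B y by rewrite BA.
apply: cA.
- by exists x.
- exists [set z | \forall w \near z, A w -> f w = f x]°.
    exact: open_interior.
  apply/seteqP; split=> z.
    move=> [Az fz]; split=> //.
    rewrite /interior /= nbhs_nearE.
    apply/near_join; move: (lf z Az); apply: filterS => w h /h ->.
    exact: fz.
  move=> [Az /interior_subset /nbhs_singleton h]; split=> //; exact: h.
- exists (~` [set z | \forall w \near z, A w -> f w <> f x]°).
    by apply: open_closedC; exact: open_interior.
  apply/seteqP; split=> z.
    move=> [Az fz]; split=> // /interior_subset /nbhs_singleton.
    by move=> /(_ Az).
  move=> [Az h]; split=> //; apply: contrapT => fz; apply: h.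
  rewrite /interior /= nbhs_nearE.
  by apply/near_join; move: (lf z Az); apply: filterS => w h /h ->.
Qed.

Lemma near_within_continuous (T U : topologicalType) (A : set T) (h : T -> U)
    (x : T) (W : set U) :
  {within A, continuous h} -> A x -> nbhs (h x) W ->
  \forall z \near x, A z -> W (h z).
Proof. by move=> /subspace_continuousP ch Ax hW; exact: ch Ax W hW. Qed.

Section IntervalInduction.
Variable R : realType.
Implicit Types (a b m t : R) (P : R -> R -> Prop).

(** Subdivision arguments on [0, 1], in place of a Lebesgue number: a property
    of intervals that is additive and holds for all small intervals around any
    given point holds for [0, 1], as the supremum of the [b] such that it holds
    on [0, b] cannot be less than 1. *)
Lemma interval_ind P :
  (forall a m b, a < m < b -> 0 <= a -> b <= 1 -> P a m -> P m b -> P a b) ->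
  (forall t, 0 <= t <= 1 -> exists2 e, 0 < e &
     forall a b, 0 <= a -> b <= 1 -> a < b -> t - e < a -> b < t + e ->
       a <= t <= b -> P a b) ->
  P 0 1.
Proof.
move=> addP locP.
pose A := [set b | 0 < b <= 1 /\ P 0 b].
have [e0 e0_gt0 P0] : exists2 e, 0 < e &
    forall b, 0 < b -> b <= 1 -> b < e -> P 0 b.
  have [|e e0 h] := locP 0; first by rewrite lexx ler01.
  exists e => // b b0 b1 be; apply: h => //; try lra.
pose b0 := Num.min 1 (e0 / 2).
have b0P : [/\ 0 < b0, b0 <= 1 & b0 < e0].
  by rewrite /b0; case: (leP 1 (e0 / 2)) => ?; split; lra.
have Ab0 : A b0 by case: b0P => *; split; [lra|exact: P0].
have ubA : ubound A 1 by move=> b [/andP[]].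
have supA : has_sup A by split; [exists b0|exists 1].
pose s := sup A.
have s1 : s <= 1 by apply: ge_sup => //; exists b0.
have s0 : 0 < s.
  by case: b0P => b00 _ _; apply: (lt_le_trans b00); exact: (ub_le_sup supA.2).
have [|e e_gt0 h] := locP s; first by lra.
have [b Ab bs] := sup_adherent e_gt0 supA.
have bles : b <= s by exact: (ub_le_sup supA.2).
have [/andP[b_gt0 b1] P0b] := Ab.
have P0s : P 0 s.
  have [<- //|bns] := eqVneq b s.
  have blts : b < s by rewrite lt_neqAle bns.
  apply: (addP 0 b s) => //; first lra.
  by apply: h => //; rewrite -/s in bs; lra.
have [<- //|sn1] := eqVneq s 1.
have slt1 : s < 1 by rewrite lt_neqAle sn1.
pose s' := Num.min 1 (s + e / 2).
have s'P : [/\ s < s', s' <= 1 & s' < s + e].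
  by rewrite /s'; case: (leP 1 (s + e / 2)) => ?; split; lra.
case: s'P => ss' s'1 s'e.
suff : s' <= s by lra.
apply: (ub_le_sup supA.2); split; first lra.
by apply: (addP 0 s s') => //; [lra|apply: h => //; lra].
Qed.

End IntervalInduction.

(** * Monodromy of flat G-bundles *)

Section Monodromy.
Variables (R : realType) (E : topologicalType) (G : groupType).
Variable delta : E -> E -> G.

(** Two sections differ near every point by a constant right factor, so that
    [delta] plays the role of the transition function of a principal G-bundle
    with discrete structure group; only its germ along the diagonal matters. *)
Definition section_at (f : E -> G) (y : E) : Prop :=
  exists g, \forall z \near y, f z = (delta y z * g)%g.

(** [phi] is a section of the pull-back along [h]. It is a function on X and not
    the composite of [h] with a function on E, as a path that comes back to a
    point may come back with another value of [phi]. *)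
Definition lift_on (X : topologicalType) (h : X -> E) (A : set X)
    (phi : X -> G) : Prop :=
  forall x, A x ->
    exists g, \forall z \near x, A z -> phi z = (delta (h x) (h z) * g)%g.

Section Lifts.
Variable X : topologicalType.
Implicit Types (h : X -> E) (A B : set X) (phi psi : X -> G).

Lemma lift_on_mulr h A phi k :
  lift_on h A phi -> lift_on h A (fun x => phi x * k)%g.
Proof.
move=> lphi x Ax; have [g hg] := lphi x Ax; exists (g * k)%g.
by apply: filterS hg => z hz Az; rewrite hz // mulgA.
Qed.

Lemma lift_on_eq h h' A phi :
  (forall x, A x -> h x = h' x) -> lift_on h A phi -> lift_on h' A phi.
Proof.
move=> hh' lphi x Ax; have [g hg] := lphi x Ax; exists g.
by apply: filterS hg => z hz Az; rewrite hz // !hh'.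
Qed.

Lemma lift_on_unique h A phi psi : connected A ->
  lift_on h A phi -> lift_on h A psi ->
  forall x y, A x -> A y ->
    ((psi x)^-1 * phi x = (psi y)^-1 * phi y)%g.
Proof.
move=> cA lphi lpsi.
apply: (@locally_constant_connected _ _ A (fun x => (psi x)^-1 * phi x)%g cA).
move=> x Ax; have [g hg] := lphi x Ax; have [k hk] := lpsi x Ax.
have := nbhs_singleton hg Ax; have := nbhs_singleton hk Ax => -> ->.
apply: filterS2 hg hk => z hgz hkz Az.
by rewrite hgz // hkz // !invgM !mulgA !mulgVK.
Qed.

Lemma lift_on_cst h A phi : connected A ->
  (forall x y, A x -> A y -> h x = h y) -> lift_on h A phi ->
  forall x y, A x -> A y -> phi x = phi y.
Proof.
move=> cA hc lphi; apply: locally_constant_connected => // x Ax.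
have [g hg] := lphi x Ax; apply: filterS (hg) => z hz Az.
by rewrite hz // (nbhs_singleton hg Ax) (hc z x).
Qed.

(** Gluing: the two lifts differ on the connected overlap by a constant, which
    corrects the second one. *)
Lemma lift_on_setU h A B phi psi : closed A -> closed B ->
  connected (A `&` B) -> lift_on h A phi -> lift_on h B psi ->
  exists Phi, lift_on h (A `|` B) Phi.
Proof.
move=> clA clB cAB lphi lpsi.
have [k hk] : exists k, forall x, A x -> B x -> phi x = (psi x * k)%g.
  have [[x0 [Ax0 Bx0]]|nAB] := pselect (A `&` B !=set0); last first.
    by exists 1%g => x Ax Bx; exfalso; apply: nAB; exists x.
  have sub (C : set X) chi : A `&` B `<=` C -> lift_on h C chi ->
      lift_on h (A `&` B) chi.
    move=> sC lC x ABx; have [g hg] := lC x (sC _ ABx); exists g.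
    by apply: filterS hg => z hz ABz; apply: hz; exact: sC.
  have lphi' : lift_on h (A `&` B) phi by apply: sub lphi => x [].
  have lpsi' : lift_on h (A `&` B) psi by apply: sub lpsi => x [].
  exists ((psi x0)^-1 * phi x0)%g => x Ax Bx.
  rewrite (lift_on_unique cAB lphi' lpsi' (x := x0) (y := x)) //.
  by rewrite mulgA mulgV mul1g.
pose Phi x := if x \in A then phi x else (psi x * k)%g.
have PhiA x : A x -> Phi x = phi x by move=> Ax; rewrite /Phi mem_set.
have PhiB x : B x -> Phi x = (psi x * k)%g.
  by move=> Bx; rewrite /Phi; case: ifPn => // /set_mem Ax; rewrite hk.
have away (C : set X) x : closed C -> ~ C x -> \forall z \near x, ~ C z.
  by move=> clC Cx; exact: (open_nbhs_nbhs (conj (closed_openC clC) Cx)).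
have lpsik := lift_on_mulr k lpsi.
exists Phi => x ABx.
have [Ax|nAx] := pselect (A x); have [Bx|nBx] := pselect (B x).
- have [g hg] := lphi x Ax; have [g' hg'] := lpsik x Bx; exists g.
  (* The two germs agree at x itself, hence they are the same. *)
  have gg' : g = g'.
    apply: (@mulgI _ (delta (h x) (h x))).
    rewrite -(nbhs_singleton hg Ax) -(nbhs_singleton hg' Bx); exact: hk.
  apply: filterS2 hg hg' => z hz hz' [Az|Bz]; first by rewrite PhiA ?hz.
  by rewrite PhiB // hz' // gg'.
- have [g hg] := lphi x Ax; exists g.
  apply: filterS2 hg (away _ _ clB nBx) => z hz nBz [Az|//].
  by rewrite PhiA ?hz.
- have [g hg] := lpsik x Bx; exists g.
  apply: filterS2 hg (away _ _ clA nAx) => z hz nAz [//|Bz].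
  by rewrite PhiB ?hz.
- by case: ABx.
Qed.

End Lifts.

Lemma lift_on_comp (X Y : topologicalType) (h : X -> E) (q : Y -> X)
    (A : set X) (B : set Y) phi :
  {within B, continuous q} -> (forall y, B y -> A (q y)) ->
  lift_on h A phi -> lift_on (h \o q) B (phi \o q).
Proof.
move=> cq qBA lphi y By; have [g hg] := lphi _ (qBA y By); exists g.
apply: filterS (near_within_continuous cq By hg) => z hz Bz /=.
by apply: hz => //; exact: qBA.
Qed.

(** The cocycle condition (near z, [delta y] and [delta z] differ by a constant
    factor) is stated as the existence of local sections; it comes with the
    local path-connectedness that the construction of global sections needs. *)
Definition locally_trivial : Prop := forall y : E, exists U : set E,
  [/\ open U, U y, forall z, U z -> section_at (delta y) z &
   forall z, U z ->
     exists c : tpath R y z, forall t : R, t \in `[0, 1] -> U (c t)].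

Hypothesis delta_local : locally_trivial.

Lemma lift_on_small (X : topologicalType) (h : X -> E) (A : set X) (y : E)
    (U : set E) :
  {within A, continuous h} -> (forall z, U z -> section_at (delta y) z) ->
  (forall x, A x -> U (h x)) -> lift_on h A (fun x => delta y (h x)).
Proof.
move=> ch hU AU x Ax; have [g hg] := hU _ (AU x Ax); exists g.
exact: near_within_continuous ch Ax hg.
Qed.

Let rect (a b c d : R) : set (R * R) := `[a, b] `*` `[c, d].

Let closed_rect a b c d : closed (rect a b c d).
Proof.
have -> : rect a b c d = fst @^-1` `[a, b] `&` snd @^-1` `[c, d] by [].
apply: closedI; apply: preimage_closed.
- by move=> z _; exact: cvg_fst.
- exact: itv_closed.
- by move=> z _; exact: cvg_snd.
- exact: itv_closed.
Qed.

Let connected_vertical m c d : connected (rect m m c d).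
Proof.
have -> : rect m m c d = (fun t => (m, t)) @` `[c, d].
  apply/seteqP; split=> [[u v]|z [t tcd <-]].
    rewrite /rect /= !in_itv /= => -[um vcd]; exists v; rewrite /= ?in_itv //=.
    by congr pair; lra.
  by split=> //=; rewrite in_itv /= lexx.
apply: connected_continuous_connected; first exact: segment_connected.
apply: continuous_subspaceT => t.
exact: (cvg_pair (@cst_continuous R R m t) (@cvg_id R (nbhs t))).
Qed.

Let connected_horizontal a b m : connected (rect a b m m).
Proof.
have -> : rect a b m m = (fun s => (s, m)) @` `[a, b].
  apply/seteqP; split=> [[u v]|z [t tab <-]].
    rewrite /rect /= !in_itv /= => -[uab vm]; exists u; rewrite /= ?in_itv //=.
    by congr pair; lra.
  by split=> //=; rewrite in_itv /= lexx.
apply: connected_continuous_connected; first exact: segment_connected.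
apply: continuous_subspaceT => t.
exact: (cvg_pair (@cvg_id R (nbhs t)) (@cst_continuous R R m t)).
Qed.

(** The square is first cut into vertical strips, then each thin strip into small
    rectangles; two consecutive pieces meet along a segment, which is connected,
    so that the lifts glue. *)
Lemma liftable_square (h : R * R -> E) :
  {within `[0, 1] `*` `[0, 1], continuous h} ->
  exists phi, lift_on h (`[0, 1] `*` `[0, 1]) phi.
Proof.
move=> ch.
have chW a b c d : 0 <= a -> b <= 1 -> 0 <= c -> d <= 1 ->
    {within rect a b c d, continuous h}.
  move=> a0 b1 c0 d1; apply: continuous_subspaceW ch => -[s t].
  by rewrite /rect /= !in_itv /=; lra.
pose liftable A := exists phi, lift_on h A phi.
apply: (@interval_ind _ (fun a b => liftable (rect a b 0 1))).
  move=> a m b amb a0 b1 [phi lphi] [psi lpsi].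
  suff -> : rect a b 0 1 = rect a m 0 1 `|` rect m b 0 1.
    apply: lift_on_setU lphi lpsi => //.
    suff -> : rect a m 0 1 `&` rect m b 0 1 = rect m m 0 1 by [].
    by apply/seteqP; split=> -[s t] /=; rewrite /rect /= !in_itv /=; lra.
  apply/seteqP; split=> -[s t]; rewrite /rect /= !in_itv /=; last by lra.
  by case: (leP s m) => ? [? ?]; [left|right]; lra.
move=> s s01.
(* Around the abscissa s, the same subdivision is made in the other direction;
   the width e of the strip may shrink at each step. *)
have [e e0 he] : exists2 e, 0 < e & forall a b, 0 <= a -> b <= 1 -> a < b ->
    s - e < a -> b < s + e -> a <= s <= b -> liftable (rect a b 0 1); last first.
  by exists e.
apply: (@interval_ind _ (fun c d => exists2 e, 0 < e & forall a b, 0 <= a ->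
  b <= 1 -> a < b -> s - e < a -> b < s + e -> a <= s <= b ->
  liftable (rect a b c d))).
  move=> c m d cmd c0 d1 [e e0 he] [e' e'0 he'].
  exists (Num.min e e'); first by rewrite lt_min e0.
  move=> a b a0 b1 ab; rewrite minEle.
  move=> sa sb sab.
  have [phi lphi] : liftable (rect a b c m).
    by apply: he => //; move: sa sb; case: (leP e e'); lra.
  have [psi lpsi] : liftable (rect a b m d).
    by apply: he' => //; move: sa sb; case: (leP e e'); lra.
  suff -> : rect a b c d = rect a b c m `|` rect a b m d.
    apply: lift_on_setU lphi lpsi => //.
    suff -> : rect a b c m `&` rect a b m d = rect a b m m by [].
    by apply/seteqP; split=> -[u v] /=; rewrite /rect /= !in_itv /=; lra.
  apply/seteqP; split=> -[u v]; rewrite /rect /= !in_itv /=; last by lra.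
  by case: (leP v m) => ? [? ?]; [left|right]; lra.
move=> t t01.
have [U [oU Uh hU _]] := delta_local (h (s, t)).
have Qst : (`[0, 1] `*` `[0, 1] : set (R * R)) (s, t).
  by split; rewrite /= in_itv.
have := near_within_continuous ch Qst (open_nbhs_nbhs (conj oU Uh)).
move=> [[V W] /= [/nbhs_ballP [e /= e0 eV] /nbhs_ballP [e' /= e'0 eW]] VW].
exists e' => // c d c0 d1 cd tc td ctd; exists e => // a b a0 b1 ab sa sb asb.
exists (fun x => delta (h (s, t)) (h x)); apply: (lift_on_small _ hU).
  exact: chW.
move=> [u v]; rewrite /rect /= !in_itv /= => -[uab vcd].
apply: VW; last by split; rewrite /= in_itv /=; lra.
split=> /=.
  by apply: eV; rewrite /ball /= ltr_norml; lra.
by apply: eW; rewrite /ball /= ltr_norml; lra.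
Qed.

Let lift_along (x y : E) (c : tpath R x y) (phi : R -> G) : Prop :=
  lift_on c `[0, 1] phi.

Let affine_cont (a b : R) : continuous (fun t : R => a * t + b).
Proof.
move=> t; apply: continuousD; last exact: cst_continuous.
by apply: continuousM; [exact: cst_continuous|exact: cvg_id].
Qed.

Let lift_affine (h h' : R -> E) (phi : R -> G) (a b : R) :
  (forall t, 0 <= t <= 1 -> 0 <= a * t + b <= 1) ->
  (forall t, 0 <= t <= 1 -> h (a * t + b) = h' t) ->
  lift_on h `[0, 1] phi ->
  lift_on h' `[0, 1] (fun t => phi (a * t + b)).
Proof.
move=> ab01 hh' lphi.
apply: (@lift_on_eq _ (h \o (fun t => a * t + b))).
  by move=> t /=; rewrite in_itv /= => t01; exact: hh'.
apply: (lift_on_comp _ _ lphi).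
  by apply: continuous_subspaceT; exact: affine_cont.
by move=> t /=; rewrite !in_itv /=; exact: ab01.
Qed.

Let lift_cat_l x y z (c : tpath R x y) (d : tpath R y z) phi :
  lift_along (tpath_cat c d) phi -> lift_along c (fun t => phi (2^-1 * t + 0)).
Proof.
apply: lift_affine => t t01; first lra.
have -> : tpath_cat c d (2^-1 * t + 0) =
  if 2^-1 * t + 0 <= 2^-1 then c (2 * (2^-1 * t + 0))
  else d (2 * (2^-1 * t + 0) - 1) by [].
by case: ifP => h; [congr (c _); lra|exfalso; lra].
Qed.

Let lift_cat_r x y z (c : tpath R x y) (d : tpath R y z) phi :
  lift_along (tpath_cat c d) phi ->
  lift_along d (fun t => phi (2^-1 * t + 2^-1)).
Proof.
apply: lift_affine => t t01; first lra.
have -> : tpath_cat c d (2^-1 * t + 2^-1) =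
  if 2^-1 * t + 2^-1 <= 2^-1 then c (2 * (2^-1 * t + 2^-1))
  else d (2 * (2^-1 * t + 2^-1) - 1) by [].
case: ifP => h; last by congr (d _); lra.
have -> : t = 0 by lra.
by rewrite mulr0 add0r divff // tpath0 tpath1.
Qed.

Let lift_rev x y (c : tpath R x y) phi :
  lift_along (tpath_rev c) phi -> lift_along c (fun t => phi (-1 * t + 1)).
Proof.
apply: lift_affine => t t01; first lra.
have -> : tpath_rev c (-1 * t + 1) = c (1 - (-1 * t + 1)) by [].
by congr (c _); lra.
Qed.

Let vertical_cont (a : R) : {within `[0, 1], continuous (fun t : R => (a, t))}.
Proof.
apply: continuous_subspaceT => t.
exact: (cvg_pair (@cst_continuous R R a t) (@cvg_id R (nbhs t))).
Qed.

Let horizontal_cont (a : R) :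
  {within `[0, 1], continuous (fun s : R => (s, a))}.
Proof.
apply: continuous_subspaceT => s.
exact: (cvg_pair (@cvg_id R (nbhs s)) (@cst_continuous R R a s)).
Qed.

Let in01 (t : R) : 0 <= t <= 1 -> `[0, 1]%classic t.
Proof. by rewrite /= in_itv. Qed.

Lemma lift_path_exists x y (c : tpath R x y) : exists phi, lift_along c phi.
Proof.
have [|Phi lPhi] := @liftable_square (c \o snd).
  apply/subspace_continuousP => -[s t] [/= _ t01].
  move=> W hW.
  have {}hW := near_within_continuous (@tpath_cont _ _ _ _ c) t01 hW.
  have : \forall z \near filter_prod (nbhs s) (nbhs t),
      `[0, 1]%classic z.2 -> W (c z.2).
    exact: (@cvg_snd _ _ (nbhs s) (nbhs t) _ _ hW).
  by apply: filterS => -[u v] /= h [/= _ /h].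
exists (Phi \o (fun t => (0, t))).
apply: (@lift_on_eq _ ((c \o snd) \o (fun t : R => (0 : R, t)))) => //.
apply: lift_on_comp lPhi; first exact: vertical_cont.
by move=> t t01; split=> //=; rewrite in_itv /= lexx ler01.
Qed.

Let seg : connected (`[0, 1]%classic : set R).
Proof. exact: segment_connected. Qed.

Hypothesis scE : simply_connected R E.

(** No monodromy: on the square of a null-homotopy the lift is constant along the
    three sides that are sent to the base point, hence takes the same value at
    the two ends of the fourth. *)
Lemma lift_loop_closed x (l : tpath R x x) phi :
  lift_along l phi -> phi 0 = phi 1.
Proof.
move=> lphi.
have : pi1_class l = pi1_class (tpath_cst R x).
  by rewrite (scE.2 x (pi1_class l)).
move/pi1_classP => [H [cH H0 H1 Hx Hy]].
have [Phi lPhi] := liftable_square cH.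
have I0 : `[0, 1]%classic (0 : R) by apply: in01; rewrite lexx ler01.
have I1 : `[0, 1]%classic (1 : R) by apply: in01; rewrite lexx ler01.
have edge_h a : `[0, 1]%classic a ->
    lift_on (fun s => H (s, a)) `[0, 1] (fun s => Phi (s, a)).
  move=> Ia; apply: (lift_on_comp (@horizontal_cont a) _ lPhi).
  by move=> s Is; split.
have edge_v a : `[0, 1]%classic a ->
    lift_on (fun t => H (a, t)) `[0, 1] (fun t => Phi (a, t)).
  move=> Ia; apply: (lift_on_comp (@vertical_cont a) _ lPhi).
  by move=> t It; split.
have E0 : Phi (0, 0) = Phi (1, 0).
  apply: (lift_on_cst seg _ (edge_h 0 I0)) => // u v Iu Iv.
  by rewrite !Hx.
have E1 : Phi (0, 1) = Phi (1, 1).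
  apply: (lift_on_cst seg _ (edge_h 1 I1)) => // u v Iu Iv.
  by rewrite !Hy.
have E2 : Phi (1, 0) = Phi (1, 1).
  apply: (lift_on_cst seg _ (edge_v 1 I1)) => // u v Iu Iv.
  by rewrite !H1.
have lPhi0 : lift_along l (fun t => Phi (0, t)).
  by apply: lift_on_eq (edge_v 0 I0) => t It; rewrite H0.
have := lift_on_unique seg lphi lPhi0 I0 I1.
by rewrite E0 E1 E2 => /mulgI.
Qed.

(** The lift of the loop that follows c and then d backwards restricts to lifts
    of c and of d with the same initial value and the same final value. *)
Lemma lift_end_unique x y (c d : tpath R x y) phi psi :
  lift_along c phi -> lift_along d psi -> phi 0 = psi 0 -> phi 1 = psi 1.
Proof.
move=> lphi lpsi phipsi0.
have I0 : `[0, 1]%classic (0 : R) by apply: in01; rewrite lexx ler01.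
have I1 : `[0, 1]%classic (1 : R) by apply: in01; rewrite lexx ler01.
have [Phi lPhi] := lift_path_exists (tpath_cat c (tpath_rev d)).
have PhiE := lift_loop_closed lPhi.
have := lift_on_unique seg lphi (lift_cat_l lPhi) I0 I1.
have := lift_on_unique seg lpsi (lift_rev (lift_cat_r lPhi)) I0 I1.
rewrite !mulr0 mulN1r addNr !addr0 !add0r !mulr1 mulr0 add0r.
rewrite (_ : 2^-1 + 2^-1 = 1 :> R); last by lra.
by rewrite phipsi0 PhiE => -> /mulgI.
Qed.

(** Flat bundles over simply connected spaces are trivial: the value at x is the
    final value of the lift that starts from 1 along any path from e0 to x. *)
Lemma global_section (e0 : E) :
  exists f, f e0 = 1%g /\ forall y, section_at f y.
Proof.
have I0 : `[0, 1]%classic (0 : R) by apply: in01; rewrite lexx ler01.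
have I1 : `[0, 1]%classic (1 : R) by apply: in01; rewrite lexx ler01.
pose hol x g := exists (c : tpath R e0 x) phi,
  [/\ lift_along c phi, phi 0 = 1%g & phi 1 = g].
have hol_end x (c : tpath R e0 x) phi g :
    lift_along c phi -> hol x g -> g = (phi 1%R * (phi 0%R)^-1)%g.
  move=> lphi [d [psi [lpsi psi0 <-]]].
  apply: (lift_end_unique lpsi (lift_on_mulr (phi 0%R)^-1%g lphi)).
  by rewrite mulgV.
have hol_ex x : exists g, hol x g.
  have [c] := scE.1 e0 x; have [phi lphi] := lift_path_exists c.
  exists (phi 1%R * (phi 0%R)^-1)%g, c, (fun t => phi t * (phi 0)^-1)%g.
  by split=> //; [exact: lift_on_mulr|rewrite mulgV].
have [f hf] := choice hol_ex.
exists f; split.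
  have [phi lphi] := lift_path_exists (tpath_cst R e0).
  by rewrite (hol_end _ _ _ _ lphi (hf e0)) -(lift_loop_closed lphi) mulgV.
move=> x; have [U [oU Ux hU wU]] := delta_local x.
exists ((delta x x)^-1 * f x)%g.
have : \forall z \near x, U z by exact: open_nbhs_nbhs.
apply: filterS => z Uz.
(* Going to z through x compares the values at x and at z, and along the path w,
   which stays in U, the lift is a multiple of the local section delta x. *)
have [w wUt] := wU z Uz; have [c] := scE.1 e0 x.
have [phi lphi] := lift_path_exists (tpath_cat c w).
rewrite (hol_end _ _ _ _ lphi (hf z)).
rewrite (hol_end _ _ _ _ (lift_cat_l lphi) (hf x)).
have lw : lift_along w (fun t => delta x (w t)).
  by apply: (lift_on_small _ hU) => //; exact: tpath_cont.
have := lift_on_unique seg (lift_cat_r lphi) lw I0 I1.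
rewrite tpath0 tpath1 !mulr0 !mulr1 !add0r !addr0.
rewrite (_ : 2^-1 + 2^-1 = 1 :> R); last by lra.
by move=> h; rewrite !mulgA -(mulgA _ _ (phi 2^-1)) h !mulgA mulgV mul1g.
Qed.

End Monodromy.

(** * Charts of the universal cover *)

Lemma within_open_near (T U : topologicalType) (D : set T) (h : T -> U)
    (x : T) (W : set U) :
  open D -> {within D, continuous h} -> D x -> nbhs (h x) W ->
  \forall z \near x, D z /\ W (h z).
Proof.
move=> oD ch Dx hW.
have hD : \forall z \near x, D z by exact: open_nbhs_nbhs.
by apply: filterS2 hD (near_within_continuous ch Dx hW) => z Dz /(_ Dz).
Qed.

Section Covering.
Variables (E B : topologicalType) (p : E -> B).
Hypothesis cov : covering_map p.

Lemma covering_continuous : continuous p.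
Proof.
move=> y W hW; have [U [sheets [oU Uy pU _ he]]] := cov.2 (p y).
have : (p @^-1` U) y by [].
rewrite pU => -[V sV Vy]; have [e [dV _ ep]] := he V sV.
have hW' : nbhs (fwd e y) W by rewrite ep.
have dy : dom e y by rewrite dV.
have := within_open_near (dom_open e) (fwd_cont (c := e)) dy hW'.
by apply: filterS => z [_]; rewrite ep.
Qed.

End Covering.

Section Charts.
Variables (R : realType) (n : nat) (M E : topologicalType) (p : E -> M).
Hypothesis cov : covering_map p.

(** In a chart of the universal cover induced by a boundary chart of M, small
    balls around the image of y meet the half-space along convex sets. The
    straight paths are used both for the local path-connectedness and, in the
    charts that flatten a hypersurface, for the connectedness of its traces. *)
Lemma chart_star_nbhs (y : E) (e : chart M 'rV[R]_n.+1) (O : set M) :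
  boundary_chart e -> dom e (p y) -> open O -> O (p y) ->
  exists U : set E,
  [/\ open U, U y, forall z, U z -> dom e (p z) /\ O (p z) &
   forall z, U z -> exists c : tpath R y z, forall t : R, t \in `[0, 1] ->
     U (c t) /\ fwd e (p (c t)) = (1 - t) *: fwd e (p y) + t *: fwd e (p z)].
Proof.
move=> [W oW codE] ey oO Oy.
have cp := covering_continuous cov.
have [U0 [sheets [oU0 U0y pU0 _ he]]] := cov.2 (p y).
have : (p @^-1` U0) y by [].
rewrite pU0 => -[V sV Vy]; have [e' [dV cU0 e'p]] := he V sV.
set v0 := fwd e (p y).
have cv0 : cod e v0 by exact: fwd_cod.
have OU0 : nbhs (bwd e v0) (O `&` U0).
  by rewrite fwdK //; apply: open_nbhs_nbhs; split=> //; exact: openI.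
have hW : nbhs v0 W.
  by apply: open_nbhs_nbhs; split=> //; move: cv0; rewrite codE => -[].
have [r r0 hr] : exists2 r, 0 < r & forall v : 'rV[R]_n.+1, `|v0 - v| < r ->
    W v /\ (cod e v -> (O `&` U0) (bwd e v)).
  have [r r0 hr] := (nbhs_normP _ _).1
    (filterI hW (near_within_continuous (bwd_cont (c := e)) cv0 OU0)).
  by exists r.
pose U := [set z | [/\ V z, dom e (p z) & `|v0 - fwd e (p z)| < r]].
have UO z : U z -> dom e (p z) /\ O (p z).
  move=> [_ ez zr]; split=> //.
  by have [_ /(_ (fwd_cod ez))] := hr _ zr; rewrite fwdK // => -[].
have Uy : U y by split=> //; rewrite subrr normr0.
exists U; split=> //.
- rewrite openE => z [Vz ez zr]; rewrite /interior /=.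
  have hV : \forall z' \near z, V z'.
    by apply: open_nbhs_nbhs; split=> //; rewrite -dV; exact: dom_open.
  have hb : nbhs (fwd e (p z)) [set v | `|v0 - v| < r].
    apply: open_nbhs_nbhs; split=> //.
    have := @ball_open R 'rV[R]_n.+1 v0 r.
    by rewrite -ball_normE.
  have := within_open_near (dom_open e) (fwd_cont (c := e)) ez hb.
  move=> /(cp z) /= hz.
  by apply: filterS2 hV hz => z' Vz' [ez' zr'].
move=> z Uz; have [Vz ez zr] := Uz.
set v1 := fwd e (p z).
pose v t : 'rV[R]_n.+1 := v0 + t *: (v1 - v0).
have vE t : v t = (1 - t) *: v0 + t *: v1.
  by rewrite /v scalerBr scalerBl scale1r addrA addrAC.
have cv : continuous v.
  move=> t; apply: cvgD; first exact: cvg_cst.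
  by apply: cvgZ; [exact: cvg_id|exact: cvg_cst].
have vr t : 0 <= t <= 1 -> `|v0 - v t| < r.
  move=> /andP[t0 t1]; apply: le_lt_trans zr.
  rewrite /v opprD addrA subrr sub0r -scalerN opprB normrZ ger0_norm //.
  by rewrite ler_piMl.
have vcod t : 0 <= t <= 1 -> cod e (v t).
  move=> t01; rewrite codE; split; first by have [] := hr _ (vr t t01).
  have : cod e v1 by exact: fwd_cod.
  move: cv0; rewrite codE => -[_ h0] [_ h1].
  move: h0 h1; rewrite /half_space /= vE !mxE => h0 h1.
  by apply: addr_ge0; apply: mulr_ge0 => //; lra.
have vOU t : 0 <= t <= 1 -> (O `&` U0) (bwd e (v t)).
  by move=> t01; have [_] := hr _ (vr t t01); apply; exact: vcod.
pose c t := bwd e' (bwd e (v t)).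
have cc : {within `[0, 1], continuous c}.
  apply/subspace_continuousP => t /=; rewrite in_itv /= => t01 N hN.
  have cd : cod e' (bwd e (v t)) by rewrite cU0; case: (vOU t t01).
  have h1 := near_within_continuous (bwd_cont (c := e')) cd hN.
  have h2 := near_within_continuous (bwd_cont (c := e)) (vcod t t01) h1.
  suff : \forall s \near t, `[0, 1]%classic s -> N (c s) by [].
  have h3 : \forall s \near t, cod e (v s) -> cod e' (bwd e (v s)) ->
      N (bwd e' (bwd e (v s))) := cv t _ h2.
  apply: filterS h3 => s hs; rewrite /= in_itv /= => s01.
  by apply: hs; [exact: vcod|rewrite cU0; case: (vOU s s01)].
have c0 : c 0 = y.
  by rewrite /c /v scale0r addr0 fwdK // -e'p fwdK // dV.
have c1 : c 1 = z.
  by rewrite /c /v scale1r addrC subrK fwdK // -e'p fwdK // dV.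
have pc t : 0 <= t <= 1 -> p (c t) = bwd e (v t).
  by move=> t01; rewrite -e'p bwdK // cU0; case: (vOU t t01).
exists (TPath cc c0 c1) => t; rewrite in_itv /= => t01.
have ect : fwd e (p (c t)) = v t by rewrite pc // bwdK //; exact: vcod.
split; last by rewrite -vE.
split; last by rewrite ect; exact: vr.
  by rewrite -dV; apply: bwd_dom; rewrite cU0; case: (vOU t t01).
by rewrite pc //; apply: bwd_dom; exact: vcod.
Qed.

End Charts.

(** * The bundle of a hypersurface *)

Section Jump.
Variables (R : realType) (n : nat) (M E : topologicalType) (p : E -> M).
Variables (S : hypersurface R n M) (G : groupWithTopologyType).
Variable gamma : set E -> G.
Hypothesis cov : covering_map p.

(** The cocycle of the deformation: crossing S from its negative to its positive
    side near y multiplies by the value of [gamma] on the lift through y. The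
    points of S are counted with the negative side. *)
Definition jump (y z : E) : G :=
  if `[< hs_set S (p y) /\ hs_pos S (p z) >] then gamma (lift_at p S y)
  else 1%g.

Lemma jump_off y z : ~ hs_set S (p y) -> jump y z = 1%g.
Proof. by move=> Sy; rewrite /jump asboolF // => -[]. Qed.

Lemma jump_pos y z : hs_set S (p y) -> hs_pos S (p z) ->
  jump y z = gamma (lift_at p S y).
Proof. by move=> Sy pz; rewrite /jump asboolT. Qed.

Lemma jump_npos y z : ~ hs_pos S (p z) -> jump y z = 1%g.
Proof. by move=> pz; rewrite /jump asboolF // => -[]. Qed.

Lemma off_hypersurface_near y : ~ hs_set S (p y) ->
  \forall z \near y, ~ hs_set S (p z).
Proof.
move=> Sy; have cp := covering_continuous cov.
have h : nbhs (p y) (~` hs_set S).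
  by apply: open_nbhs_nbhs; split=> //; exact: closed_openC (hs_closed (h := S)).
exact: cp y _ h.
Qed.

Lemma sides_disjoint_near y : hs_set S (p y) -> \forall z \near y,
  [/\ hs_pos S (p z) -> ~ hs_set S (p z), hs_neg S (p z) -> ~ hs_set S (p z) &
      hs_pos S (p z) -> ~ hs_neg S (p z)].
Proof.
move=> Sy; have cp := covering_continuous cov.
have [e [_ ey he]] := hs_flat Sy.
have h : nbhs (p y) (dom e).
  by apply: open_nbhs_nbhs; split=> //; exact: dom_open.
have hz : \forall z \near y, dom e (p z) := cp y _ h.
apply: filterS hz => z /he [hS hp hn].
by split; rewrite ?hS ?hp ?hn; lra.
Qed.

Hypothesis mfd : manifold R n M.

(** The point is that the trace of S on a small flat chart is connected, hence
    contained in a single lift, so that one value of [gamma] is involved. *)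
Lemma jump_locally_trivial : locally_trivial R jump.
Proof.
move=> y.
have [Sy|Sy] := pselect (hs_set S (p y)); last first.
  have [_ _ /(_ (p y)) [e be ey]] := mfd.
  have oO := closed_openC (hs_closed (h := S)).
  have [U [oU Uy UO Uc]] := chart_star_nbhs cov be ey oO Sy.
  exists U; split=> //.
    move=> z Uz; exists 1%g; apply: nearW => w.
    by rewrite !jump_off ?mulg1 //; case: (UO z Uz).
  by move=> z /Uc [c hc]; exists c => t /hc [].
have [e [be ey he]] := hs_flat Sy.
have [U [oU Uy UO Uc]] := chart_star_nbhs cov be ey openT I.
exists U; split=> //; last by move=> z /Uc [c hc]; exists c => t /hc [].
move=> z Uz; have [ez _] := UO z Uz; have [c hc] := Uc z Uz.
have [hSz hpz hnz] := he _ ez.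
have [Sz|Sz] := pselect (hs_set S (p z)).
  have lyz : lift_at p S y = lift_at p S z.
    apply: same_connected_component.
    have cI : connected (c @` `[0, 1]).
      apply: connected_continuous_connected; first exact: segment_connected.
      exact: (@tpath_cont _ _ _ _ c).
    apply: (connected_component_max _ _ cI).
    - by exists 0; [rewrite /= in_itv /= lexx ler01|rewrite tpath0].
    - move=> _ [t t01 <-] /=; have [Uct ect] := hc t t01.
      have [ec _] := UO _ Uct; have [-> _ _] := he _ ec.
      have [/iffLR/(_ Sy) y0 _ _] := he _ ey.
      by rewrite ect !mxE y0 (hSz.1 Sz) !mulr0 addr0.
    - by exists 1; [rewrite /= in_itv /= lexx ler01|rewrite tpath1].
  exists 1%g; apply: nearW => w; rewrite mulg1 /jump lyz.
  by congr (if _ then _ else _); apply/asboolP/asboolP => -[_ ?]; split.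
pose L (w : E) : R := fwd e (p w) ord0 ord_max.
have L0 : L z != 0 by apply/eqP => /hSz.
have Lz : \forall w \near z, dom e (p w) /\ `|L z - L w| < `|L z|.
  have h : nbhs (fwd e (p z))
      [set v : 'rV[R]_n.+1 | `|L z - v ord0 ord_max| < `|L z|].
    apply: (@coord_continuous R 1 n.+1 ord0 ord_max (fwd e (p z))
      (ball (L z) `|L z|)).
    by apply: nbhsx_ballx; rewrite normr_gt0.
  have h' := within_open_near (dom_open e) (fwd_cont (c := e)) ez h.
  exact: (covering_continuous cov h').
exists (jump y z); apply: filterS Lz => w [ew Lw].
rewrite (jump_off w Sz) mul1g /jump.
congr (if _ then _ else _).
have [_ hpw _] := he _ ew.
by apply/asboolP/asboolP => -[_ /[dup] h]; [move/hpw|move/hpz] => h';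
  split=> //; [apply/hpz|apply/hpw]; move: h' Lw L0; rewrite -!/(L _);
  case: (ltrgt0P (L z)) => //; rewrite ltr_norml; lra.
Qed.

Lemma jump_section (e0 : E) : simply_connected R E ->
  exists f, f e0 = 1%g /\ forall y, section_at jump f y.
Proof. by move=> scE; apply: (global_section jump_locally_trivial scE). Qed.

End Jump.

(** * Crossing products as parallel transport *)

Lemma near_ballE (R : realType) (t : R) (P : R -> Prop) :
  (\forall s \near t, P s) ->
  exists2 e, 0 < e & forall s, t - e < s -> s < t + e -> P s.
Proof.
move=> /nbhs_ballP[e /= e0 he]; exists e => // s ts st.
by apply: he; rewrite /ball /= ltr_norml; lra.
Qed.

Section Crossing.
Variables (R : realType) (n : nat) (M E : topologicalType) (p : E -> M).
Variables (S : hypersurface R n M) (G : groupWithTopologyType).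
Variables (gamma : set E -> G) (f : E -> G).
Hypothesis cov : covering_map p.
Hypothesis hf : forall y, section_at (jump p S gamma) f y.

Variable c : R -> E.
Hypothesis cc : {within `[0, 1], continuous c}.
Hypothesis c_transverse : forall t : R, 0 < t < 1 -> hs_set S (p (c t)) ->
  crosses_pos p S c t \/ crosses_neg p S c t.
Hypothesis c0S : ~ hs_set S (p (c 0)).
Hypothesis c1S : ~ hs_set S (p (c 1)).

Let on (t : R) : Prop := hs_set S (p (c t)).

Let letter (t : R) : G :=
  if `[< crosses_pos p S c t >] then gamma (lift_at p S (c t))
  else (gamma (lift_at p S (c t)))^-1%g.

(** Transversality at a crossing: a section is constant just before and just after
    it, and is multiplied by the corresponding letter of the crossing product.
    In particular crossings are isolated. *)
Lemma section_crossing t : 0 <= t <= 1 -> exists e gl gr, [/\ 0 < e,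
  forall s, 0 <= s -> t - e < s < t -> f (c s) = gl /\ ~ on s,
  forall s, s <= 1 -> t < s < t + e -> f (c s) = gr /\ ~ on s,
  on t -> gr = (letter t * gl)%g &
  ~ on t -> gl = f (c t) /\ gr = f (c t)].
Proof.
move=> t01; have [g hg] := hf (c t).
have It : `[0, 1]%classic t by rewrite /= in_itv.
have ng := near_within_continuous cc It hg.
have in01 (s : R) : 0 <= s -> s <= 1 -> `[0, 1]%classic s.
  by rewrite /= in_itv /= => -> ->.
have [ont|ont] := pselect (on t); last first.
  have ns := near_within_continuous cc It (off_hypersurface_near cov ont).
  have [e e0 he] := near_ballE (filterI ng ns).
  have hs s : 0 <= s -> s <= 1 -> t - e < s -> s < t + e ->
      f (c s) = g /\ ~ on s.
    move=> s0 s1 ts st; have [h1 h2] := he s ts st; split; last exact/h2/in01.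
    by rewrite h1 ?jump_off ?mul1g //; exact: in01.
  have fct : f (c t) = g by case: (hs t) => //; lra.
  exists e, g, g; split=> //.
  - by move=> s s0 st; apply: hs; lra.
  - by move=> s s1 st; apply: hs; lra.
have t_in : 0 < t < 1.
  case/andP: t01; rewrite !le_eqVlt => /orP[/eqP t0|->].
    by exfalso; apply: c0S; rewrite t0.
  case/orP=> [/eqP t1|-> //].
  by exfalso; apply: c1S; rewrite -t1.
have nd := near_within_continuous cc It (sides_disjoint_near cov ont).
have at_leftE (P : R -> Prop) : (\forall s \near t^'-, P s) ->
    \forall s \near t, s < t -> P s by [].
have at_rightE (P : R -> Prop) : (\forall s \near t^'+, P s) ->
    \forall s \near t, t < s -> P s by [].
have [[/at_leftE cl /at_rightE cr]|[/at_leftE cl /at_rightE cr]] :=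
  c_transverse t_in ont.
- have cpos : crosses_pos p S c t by [].
  have [e e0 he] := near_ballE (filterI (filterI ng nd) (filterI cl cr)).
  exists e, g, (gamma (lift_at p S (c t)) * g)%g; split=> //.
  + move=> s s0 st; have [||[h1 h2] [h3 _]] := he s; [lra|lra|].
    have Is : `[0, 1]%classic s by apply: in01; lra.
    have sneg : hs_neg S (p (c s)) by apply: h3; lra.
    have [_ h4 h5] := h2 Is.
    split; last exact: h4.
    by rewrite h1 // jump_npos ?mul1g // => /h5.
  + move=> s s1 st; have [||[h1 h2] [_ h3]] := he s; [lra|lra|].
    have Is : `[0, 1]%classic s by apply: in01; lra.
    have spos : hs_pos S (p (c s)) by apply: h3; lra.
    have [h4 _ h5] := h2 Is.
    split; last exact: h4.
    by rewrite h1 // jump_pos.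
  + by move=> _; rewrite /letter asboolT.
- have [e e0 he] := near_ballE (filterI (filterI ng nd) (filterI cl cr)).
  exists e, (gamma (lift_at p S (c t)) * g)%g, g; split=> //.
  + move=> s s0 st; have [||[h1 h2] [h3 _]] := he s; [lra|lra|].
    have Is : `[0, 1]%classic s by apply: in01; lra.
    have spos : hs_pos S (p (c s)) by apply: h3; lra.
    have [h4 _ h5] := h2 Is.
    split; last exact: h4.
    by rewrite h1 // jump_pos.
  + move=> s s1 st; have [||[h1 h2] [_ h3]] := he s; [lra|lra|].
    have Is : `[0, 1]%classic s by apply: in01; lra.
    have sneg : hs_neg S (p (c s)) by apply: h3; lra.
    have [_ h4 h5] := h2 Is.
    split; last exact: h4.
    by rewrite h1 // jump_npos ?mul1g // => /h5.
  + (* A crossing is not both positive and negative: just before it, the path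
       would be on both sides of S. *)
    move=> _; rewrite /letter asboolF ?mulgA ?mulVg ?mul1g // => -[/at_leftE cl' _].
    have [e' e'0 he'] := near_ballE (filterI (filterI cl' cl) nd).
    pose s := t - Num.min (e' / 2) (t / 2).
    have [||[h1 h2] h3] := he' s.
    * by rewrite /s; case: (leP (e' / 2) (t / 2)); lra.
    * by rewrite /s; case: (leP (e' / 2) (t / 2)); lra.
    have st : s < t by rewrite /s; case: (leP (e' / 2) (t / 2)); lra.
    have s0 : 0 < s by rewrite /s; case: (leP (e' / 2) (t / 2)); lra.
    have [|_ _ h4] := h3; first by apply: in01; lra.
    exact: h4 (h2 st) (h1 st).
Qed.

(** One-sided limits are compared, as a and b may be crossing times themselves. *)
Let right_val (a : R) (g : G) : Prop :=
  exists2 e, 0 < e & forall s, s <= 1 -> a < s < a + e -> f (c s) = g.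

Let left_val (b : R) (g : G) : Prop :=
  exists2 e, 0 < e & forall s, 0 <= s -> b - e < s < b -> f (c s) = g.

Let right_valE a m g g' : 0 <= a -> a < m -> m <= 1 -> right_val a g ->
  (forall s, a < s < m -> f (c s) = g') -> g = g'.
Proof.
move=> a0 am m1 [e e0 he] hm; pose s := a + Num.min (e / 2) ((m - a) / 2).
have ? : a < s /\ s < a + e.
  by rewrite /s; case: (leP (e / 2) ((m - a) / 2)); lra.
have ? : s < m by rewrite /s; case: (leP (e / 2) ((m - a) / 2)); lra.
by rewrite -(he s) ?(hm s) //; lra.
Qed.

Let left_valE b m g g' : 0 <= m -> m < b -> b <= 1 -> left_val b g ->
  (forall s, m < s < b -> f (c s) = g') -> g = g'.
Proof.
move=> m0 mb b1 [e e0 he] hm; pose s := b - Num.min (e / 2) ((b - m) / 2).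
have ? : s < b /\ b - e < s.
  by rewrite /s; case: (leP (e / 2) ((b - m) / 2)); lra.
have ? : m < s by rewrite /s; case: (leP (e / 2) ((b - m) / 2)); lra.
by rewrite -(he s) ?(hm s) //; lra.
Qed.

(** The finiteness of the crossing times and the product formula are proved
   together, by subdivision: both are additive, and hold on small intervals. *)
Let crossed (a b : R) : Prop := exists ts : seq R,
  [/\ sorted <%R ts, forall t, t \in ts <-> a < t < b /\ on t &
   forall gl gr, right_val a gl -> left_val b gr ->
     gr = ((\prod_(t <- rev ts) letter t) * gl)%g].

Let crossed_add a m b : a < m < b -> 0 <= a -> b <= 1 ->
  crossed a m -> crossed m b -> crossed a b.
Proof.
move=> amb a0 b1 [ts [sts tsP tsE]] [us [sus usP usE]].
have [|e [gl [gr [e0 hl hr h1 h2]]]] := section_crossing (t := m); first lra.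
have lm : left_val m gl by exists e => // s s0 /(hl s s0) [].
have rm : right_val m gr by exists e => // s s1 /(hr s s1) [].
pose ms := if `[< on m >] then [:: m] else [::].
have msP t : t \in ms <-> t = m /\ on m.
  rewrite /ms; case: asboolP => om; last by split=> // -[].
  by rewrite inE; split=> [/eqP|[->]].
have msE : gr = ((\prod_(t <- ms) letter t) * gl)%g.
  rewrite /ms; case: asboolP => om; first by rewrite big_seq1; exact: h1.
  by have [-> ->] := h2 om; rewrite big_nil mul1g.
exists (ts ++ ms ++ us); split.
- move: sts sus; rewrite !lt_sorted_pairwise => sts sus.
  rewrite !pairwise_cat sts sus /= !andbT.
  apply/and3P; split.
  + apply/allrelP => x y /tsP [? _]; rewrite mem_cat.
    by case/orP => [/msP [-> _]|/usP[? _]]; lra.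
  + apply/allrelP => x y /msP [-> _] /usP[? _]; lra.
  + by rewrite /ms; case: asboolP.
- move=> t; rewrite !mem_cat; split.
    case/or3P => [/tsP[? ?]|/msP[-> ?]|/usP[? ?]]; split=> //; lra.
  move=> [tab ont]; apply/or3P; case: (ltrgtP t m) => tm.
  + by constructor 1; apply/tsP; split=> //; lra.
  + by constructor 3; apply/usP; split=> //; lra.
  + by constructor 2; apply/msP; split=> //; rewrite -tm.
- move=> g g' ra lb; rewrite (usE _ _ rm lb) msE (tsE _ _ ra lm).
  rewrite !rev_cat !big_cat /= !mulgA; congr (_ * _ * _ * _)%g.
  by rewrite /ms; case: ifP.
Qed.

Let crossed_local t : 0 <= t <= 1 -> exists2 e, 0 < e &
  forall a b, 0 <= a -> b <= 1 -> a < b -> t - e < a -> b < t + e ->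
    a <= t <= b -> crossed a b.
Proof.
move=> t01; have [e [gl [gr [e0 hl hr h1 h2]]]] := section_crossing t01.
exists e => // a b a0 b1 ab ta bt atb.
have [abt|abt] := boolP ((a < t < b) && `[< on t >]).
  have /andP[{}abt /asboolP ont] := abt.
  exists [:: t]; split=> //.
    move=> s; rewrite inE; split=> [/eqP -> //|[sab ons]].
    apply/eqP; case: (ltrgtP s t) => // st; exfalso.
      by have [||_] := hl s; [lra|lra|apply].
    by have [||_] := hr s; [lra|lra|apply].
  move=> g g' ra lb; rewrite big_seq1.
  rewrite (right_valE (m := t) (g' := gl) _ _ _ ra); [|lra..|]; last first.
    by move=> s ?; case: (hl s) => //; lra.
  rewrite (left_valE (m := t) (g' := gr) _ _ _ lb); [|lra..|]; last first.
    by move=> s ?; case: (hr s) => //; lra.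
  exact: h1.
exists [::]; split=> //.
  move=> s; split=> // -[sab ons]; exfalso; case: (ltrgtP s t) => st.
  - by have [||_] := hl s; [lra|lra|apply].
  - by have [||_] := hr s; [lra|lra|apply].
  - by move: abt; rewrite -st sab /= => /asboolP.
move=> g g' ra lb; rewrite big_nil mul1g.
have [t_a|t_b|t_in] : [\/ t = a, t = b | a < t < b].
- case/andP: atb; rewrite !le_eqVlt => /orP[/eqP ->|-> ]; first by constructor 1.
  by case/orP=> [/eqP ->|->]; [constructor 2|constructor 3].
- rewrite (right_valE (m := b) (g' := gr) _ _ _ ra); [|lra..|]; last first.
    by move=> s ?; case: (hr s) => //; lra.
  rewrite (left_valE (m := a) (g' := gr) _ _ _ lb) //; [lra..|].
  by move=> s ?; case: (hr s) => //; lra.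
- rewrite (right_valE (m := b) (g' := gl) _ _ _ ra); [|lra..|]; last first.
    by move=> s ?; case: (hl s) => //; lra.
  rewrite (left_valE (m := a) (g' := gl) _ _ _ lb) //; [lra..|].
  by move=> s ?; case: (hl s) => //; lra.
have nont : ~ on t by move: abt; rewrite t_in => /asboolP.
have [El Er] := h2 nont.
rewrite (right_valE (m := t) (g' := gl) _ _ _ ra); [|lra..|]; last first.
  by move=> s ?; case: (hl s) => //; lra.
rewrite (left_valE (m := t) (g' := gr) _ _ _ lb); [|lra..|]; last first.
  by move=> s ?; case: (hr s) => //; lra.
by rewrite El Er.
Qed.

Lemma crossing_timesP : sorted <%R (crossing_times p S c) /\
  forall t, t \in crossing_times p S c <-> 0 < t < 1 /\ hs_set S (p (c t)).
Proof.
have [ts [sts tsP _]] := interval_ind crossed_add crossed_local.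
rewrite /crossing_times.
set P := [set ts | _]; have : P (xget [::] P) by apply: xgetPex; exists ts.
by [].
Qed.

(** The crossing product depends only on the end points of the path: it is the
    variation of a global section, each crossing contributing its letter. *)
Lemma crossing_productE :
  crossing_product p S gamma c = (f (c 1%R) * (f (c 0%R))^-1)%g.
Proof.
have [ts [sts tsP tsE]] := interval_ind crossed_add crossed_local.
have [scs csP] := crossing_timesP.
have Ets : crossing_times p S c = ts.
  by apply: lt_sorted_eq => // t; apply/idP/idP => [/csP/tsP|/tsP/csP].
rewrite /crossing_product Ets.
have r0 : right_val 0 (f (c 0)).
  have [|e [gl [gr [e0 _ hr _ /(_ c0S) [_ Er]]]]] := section_crossing (t := 0).
    by rewrite lexx ler01.
  by exists e => // s s1 /(hr s s1) [-> _].
have l1 : left_val 1 (f (c 1)).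
  have [|e [gl [gr [e0 hl _ _ /(_ c1S) [El _]]]]] := section_crossing (t := 1).
    by rewrite lexx ler01.
  by exists e => // s s0 /(hl s s0) [-> _].
by rewrite (tsE _ _ r0 l1) mulgK.
Qed.

End Crossing.

(** * Restriction of minimal paths and transported maps *)

Lemma section_unique (R : realType) (E : topologicalType) (G : groupType)
    (delta : E -> E -> G) (f f' : E -> G) (e0 x : E) :
  simply_connected R E -> (forall y, section_at delta f y) ->
  (forall y, section_at delta f' y) -> f e0 = f' e0 -> f x = f' x.
Proof.
move=> [/(_ e0 x)[c] _] hf hf' ff'.
have cI : connected (c @` `[0, 1]).
  apply: connected_continuous_connected; first exact: segment_connected.
  exact: (@tpath_cont _ _ _ _ c).
have c0 : (c @` `[0, 1]) e0.
  by exists 0; [rewrite /= in_itv /= lexx ler01|rewrite tpath0].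
have c1 : (c @` `[0, 1]) x.
  by exists 1; [rewrite /= in_itv /= lexx ler01|rewrite tpath1].
have lift_of h : (forall y, section_at delta h y) ->
    lift_on delta id (c @` `[0, 1]) h.
  by move=> hh y _; have [g hg] := hh y; exists g; apply: filterS hg.
have := lift_on_unique cI (lift_of _ hf) (lift_of _ hf') c0 c1.
by rewrite ff' mulVg => /esym /(canRL (mulKg _)); rewrite invgK mulg1.
Qed.

Section Minimal.
Variables (R : realType) (n : nat) (M E : topologicalType) (p : E -> M).
Variable Sigma : set (hypersurface R n M).

Lemma minimal_path_restrict (c : R -> E) (t : R) : 0 < t < 1 ->
  minimal_path p Sigma c -> minimal_path p Sigma (fun s => c (t * s)).
Proof.
move=> /andP[t0 t1] [cc cS].
have ct : continuous (fun s : R => t * s).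
  by move=> s; apply: continuousM; [exact: cst_continuous|exact: cvg_id].
have t_in s : 0 < s < 1 -> 0 < t * s < 1.
  move=> /andP[s0 s1]; rewrite mulr_gt0 //=.
  by apply: lt_trans t1; rewrite gtr_pMr.
have near_t (P : R -> Prop) s : (\forall u \near t * s, P u) ->
    \forall u \near s, P (t * u) by move=> /ct.
split.
  apply/subspace_continuousP => s; rewrite /= in_itv /= => s01 N hN.
  have ts01 : `[0, 1]%classic (t * s) by rewrite /= in_itv /=; nra.
  have := near_t _ _ (near_within_continuous cc ts01 hN).
  suff imp u : (`[0, 1]%classic (t * u) -> N (c (t * u))) ->
      `[0, 1]%classic u -> N (c (t * u)) by apply: filterS.
  by move=> h; rewrite /= in_itv /= => u01; apply: h; rewrite /= in_itv /=; nra.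
move=> S SS; have [trans once] := cS S SS; split.
  move=> s /t_in ts Ss.
  have left P : (\forall u \near (t * s)^'-, P (c u)) ->
      \forall u \near s^'-, P (c (t * u)).
    by move=> /near_t; apply: filterS => u h us; apply: h; rewrite ltr_pM2l.
  have right P : (\forall u \near (t * s)^'+, P (c u)) ->
      \forall u \near s^'+, P (c (t * u)).
    by move=> /near_t; apply: filterS => u h us; apply: h; rewrite ltr_pM2l.
  case: (trans _ ts Ss) => -[hl hr]; [left|right].
    split; first exact: (left (fun z => hs_neg S (p z))).
    exact: (right (fun z => hs_pos S (p z))).
  split; first exact: (left (fun z => hs_pos S (p z))).
  exact: (right (fun z => hs_neg S (p z))).
move=> C SC s s'; rewrite !in_itv /= => s01 s'01 Cs Cs'.
apply: (@mulfI _ t); first by rewrite gt_eqF.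
by apply: (once C SC) => //; rewrite in_itv /=; nra.
Qed.

End Minimal.

Section Transport.
Variables (R : realType) (n : nat) (M E : topologicalType) (p : E -> M).
Variables (e0 : E) (Sigma : set (hypersurface R n M)).
Variables (S S' : hypersurface R n M) (G : groupWithTopologyType).
Variables (gamma alpha : set E -> G).
Hypothesis cov : covering_map p.
Hypothesis mfd : manifold R n M.
Hypothesis scE : simply_connected R E.
Hypothesis SSigma : Sigma S.
Hypothesis S'Sigma : Sigma S'.
Hypothesis disj : (S : set M) `&` (S' : set M) = set0.
Hypothesis e0S : ~ hs_set S (p e0).
Hypothesis e0S' : ~ hs_set S' (p e0).

Let disjP x : hs_set S x -> ~ hs_set S' x.
Proof.
move=> Sx S'x; have : ((S : set M) `&` (S' : set M)) x by [].
by rewrite disj.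
Qed.

Lemma section_lift_constant (f : E -> G) y z :
  (forall x, section_at (jump p S' alpha) f x) ->
  hs_set S (p y) -> lift_at p S y z -> f z = f y.
Proof.
move=> hf Sy yz.
apply: (@locally_constant_connected _ _ (lift_at p S y)) => //.
- exact: component_connected.
- move=> x /connected_component_sub Sx; have [g hg] := hf x.
  have fx := nbhs_singleton hg; apply: filterS hg => w -> _.
  by rewrite fx !jump_off //; exact: disjP.
- exact: connected_component_refl.
Qed.

(** The initial segment of a minimal path up to a crossing with a lift C of S is
    itself a minimal path to C. So minimal paths to C exist, and whichever one
    defines the transported map, its crossing product is the value on C of the
    normalized section f, which does not jump along C. *)
Lemma transportE (f : E -> G) (c : R -> E) (t : R) :
  (forall y, section_at (jump p S' alpha) f y) -> f e0 = 1%g ->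
  minimal_path p Sigma c -> c 0 = e0 -> 0 < t < 1 -> hs_set S (p (c t)) ->
  transport p e0 Sigma S' alpha gamma (lift_at p S (c t)) =
  ((f (c t))^-1 * gamma (lift_at p S (c t)) * f (c t))%g.
Proof.
move=> hf f0 mc c0 t01 St; rewrite /transport /minimal_path_to.
set D := [set _ | _].
have [[dc dS] d0 Cd1] : D (xget (cst e0) D).
  apply: xgetPex; exists (fun s => c (t * s)); split.
  - exact: minimal_path_restrict.
  - by rewrite mulr0.
  - by rewrite mulr1; exact: connected_component_refl.
have Sd1 : hs_set S (p (xget (cst e0) D 1)).
  exact: connected_component_sub Cd1.
rewrite (crossing_productE cov hf) //.
- rewrite d0 f0 invg1 mulg1.
  by rewrite (section_lift_constant hf St Cd1).
- exact: (dS S' S'Sigma).1.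
- by rewrite d0.
- exact: disjP.
Qed.

(** A deformation along S' followed by the transported deformation along S is a
    single deformation along the union of S and S', with the original data on
    both: if k jumps by the conjugate of [gamma] by f across a lift of S, then
    f * k jumps by [gamma] itself. *)
Lemma composite_section : exists F : E -> G,
  [/\ F e0 = 1%g,
      forall y, section_at
        (fun y z => jump p S gamma y z * jump p S' alpha y z)%g F y &
      forall c : R -> E, minimal_path p Sigma c -> c 0 = e0 ->
        ~ hs_set S (p (c 1)) -> ~ hs_set S' (p (c 1)) ->
        (crossing_product p S' alpha c *
         crossing_product p S (transport p e0 Sigma S' alpha gamma) c)%g =
        F (c 1)].
Proof.
have [f [f0 hf]] := jump_section S' alpha cov mfd e0 scE.
(* The conjugate of gamma by f is taken on every lift of S, whereas the
   transported map is known to be this conjugate only on the lifts that some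
   minimal path reaches. *)
pose gammaT C := ((f (xget e0 C))^-1 * gamma C * f (xget e0 C))%g.
have gammaTE y : hs_set S (p y) ->
    gammaT (lift_at p S y) = ((f y)^-1 * gamma (lift_at p S y) * f y)%g.
  move=> Sy; rewrite /gammaT (section_lift_constant (y := y) hf) //.
  by apply: xgetPex; exists y; exact: connected_component_refl.
have [k [k0 hk]] := jump_section S gammaT cov mfd e0 scE.
exists (fun x => f x * k x)%g; split.
- by rewrite f0 k0 mulg1.
- move=> y; have [g hg] := hf y; have [g' hg'] := hk y.
  have fy := nbhs_singleton hg.
  have [Sy|Sy] := pselect (hs_set S (p y)).
    have S'y := disjP Sy.
    exists (g * g')%g; apply: filterS2 hg hg' => z -> ->.
    rewrite jump_off // mul1g in fy; rewrite !(jump_off _ _ S'y) mul1g mulg1.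
    have [pz|nz] := pselect (hs_pos S (p z)).
      by rewrite !jump_pos // gammaTE // fy !mulgA mulgV mul1g.
    by rewrite !jump_npos // !mul1g.
  exists (g * g')%g; apply: filterS2 hg hg' => z -> ->.
  by rewrite !(jump_off _ _ Sy) !mul1g !mulgA.
- move=> c mc c0 c1S c1S'; have [cc cS] := mc.
  have c0S : ~ hs_set S (p (c 0)) by rewrite c0.
  have c0S' : ~ hs_set S' (p (c 0)) by rewrite c0.
  have trS := (cS S SSigma).1; have trS' := (cS S' S'Sigma).1.
  rewrite (crossing_productE cov hf cc trS' c0S' c1S') c0 f0 invg1 mulg1.
  congr (_ * _)%g.
  transitivity (crossing_product p S gammaT c); last first.
    by rewrite (crossing_productE cov hk cc trS c0S c1S) c0 k0 invg1 mulg1.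
  have [_ tsP] := crossing_timesP cov hk cc trS c0S c1S.
  apply: eq_big_seq => t; rewrite mem_rev => /tsP [t01 St].
  by rewrite (transportE hf f0 mc c0 t01 St) gammaTE.
Qed.

End Transport.

Lemma deck_action_fiber (R : realType) (M E : topologicalType) (p : E -> M)
    (x0 : M) (e0 : E) (A : pi1 R x0) : p (deck_action p e0 A e0) = p e0.
Proof.
rewrite /deck_action; case: xgetP => // f _ [[_ _ pf] _].
by have : (p \o f) e0 = p e0 by rewrite pf.
Qed.

(** When no minimal path reaches the translate of e0, the default is the constant
    path at e0, which is minimal as well. *)
Lemma minimal_path_to_deck (R : realType) (n : nat) (M E : topologicalType)
    (p : E -> M) (x0 : M) (e0 : E) (Sigma : set (hypersurface R n M))
    (A : pi1 R x0)
    (c := minimal_path_to p e0 Sigma [set deck_action p e0 A e0]) :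
  (forall S, Sigma S -> ~ hs_set S (p e0)) ->
  [/\ minimal_path p Sigma c, c 0 = e0 & p (c 1) = p e0].
Proof.
move=> offS; rewrite /c /minimal_path_to.
case: xgetP => [d _ [md d0 /= ->]|_]; first by rewrite deck_action_fiber.
split=> //; split.
  by apply: continuous_subspaceT => t; exact: cst_continuous.
move=> S /offS Se0; split=> [t _ /Se0 //|C [y Sy <-] t t' _ _ h _].
by have := connected_component_sub h.
Qed.

Theorem corollary2p10 (R : realType) (n : nat) (M Mt : topologicalType)
    (p : Mt -> M) (x0 : M) (xt0 : Mt) (N N' : hypersurface R n M)
    (G : groupWithTopologyType) (rho : pi1 R x0 -> G)
    (gamma alpha : set Mt -> G)
    (hdim : (2 <= n.+1)%N)
    (hM : manifold R n M)
    (hM_connected : connected [set: M])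
    (hM_aspherical : aspherical R M)
    (hM_pi1 : finitely_generated (pi1 R x0))
    (hp : universal_cover R p)
    (hxt0 : p xt0 = x0)
    (hN_disjoint : (N : set M) `&` (N' : set M) = set0)
    (hN_homotopic : ~ homotopic_subsets R N N')
    (hx0N : ~ hs_set N x0)
    (hx0N' : ~ hs_set N' x0)
    (hG : lie_group R G)
    (hrho : {morph rho : A B / (A * B)%g})
    (hgamma : equivariant p xt0 rho N gamma)
    (halpha : equivariant p xt0 rho N' alpha) :
  let Sigma : set (hypersurface R n M) := [set N; N'] in
  let gammaE := transport p xt0 Sigma N' alpha gamma in
  let alphaE := transport p xt0 Sigma N gamma alpha in
  deformation p xt0 Sigma N gammaE (deformation p xt0 Sigma N' alpha rho) =
  deformation p xt0 Sigma N' alphaE (deformation p xt0 Sigma N gamma rho).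
Proof.
move=> Sigma gammaE alphaE; have [cov scE] := hp.
have SN : Sigma N by left.
have SN' : Sigma N' by right.
have offN : ~ hs_set N (p xt0) by rewrite hxt0.
have offN' : ~ hs_set N' (p xt0) by rewrite hxt0.
have disj' : (N' : set M) `&` (N : set M) = set0 by rewrite setIC.
have [F [F0 hF FE]] :=
  composite_section gamma alpha cov hM scE SN SN' hN_disjoint offN offN'.
have [F' [F'0 hF' F'E]] :=
  composite_section alpha gamma cov hM scE SN' SN disj' offN' offN.
have jumpC y z : (jump p N gamma y z * jump p N' alpha y z =
                  jump p N' alpha y z * jump p N gamma y z)%g.
  have [Ny|Ny] := pselect (hs_set N (p y)); last first.
    by rewrite (jump_off _ _ Ny) mul1g mulg1.
  have N'y : ~ hs_set N' (p y).
    by move=> N'y; have : (N `&` N') (p y) by []; rewrite hN_disjoint.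
  by rewrite (jump_off _ _ N'y) mul1g mulg1.
have hF2 y : section_at
    (fun y z => jump p N' alpha y z * jump p N gamma y z)%g F y.
  have [g hg] := hF y; exists g; apply: filterS hg => z ->.
  by rewrite jumpC.
(* Both composite sections have the jumps of gamma and alpha, and agree at the
   base point. *)
have FF' x : F x = F' x.
  by apply: (section_unique (e0 := xt0) x scE hF2 hF'); rewrite F0.
apply/funext => A; rewrite /deformation -!mulgA; congr (_ * _)%g.
have [|mc c0 c1] := @minimal_path_to_deck R n M Mt p x0 xt0 Sigma A.
  by move=> S [->|->].
rewrite /gammaE FE ?c1 // /alphaE F'E ?c1 //.
Qed.
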